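(* Let $d\ge2$ and let $\Omega\subseteq\left[-\frac12,\frac12\right)^d$ be a measurable set. Assume there exist constants $\kappa_2>0$, $0<\beta_2<1$ and $v\in\Sigma_{d-1}$ such that for all sufficiently large $\rho$ and for every $\Theta\in\Sigma_{d-1}$, $$|\widehat{\chi_\Omega}(\rho\Theta)|^2\;\le\;\begin{cases}\dfrac{\kappa_2}{\rho^{d+1}} & \text{if } |\Theta\cdot v|\le\beta_2,\\[2mm] \dfrac{\kappa_2}{\rho^{d+2}} & \text{if } \beta_2<|\Theta\cdot v|.\end{cases}$$ Then there exist a constant $c>0$ and a diverging sequence of integers $N_j$ such that for every $j$ there exists a finite sequence of points $z_1,\dots,z_{N_j}\in\mathbb{T}^d$ for which $$\int_{\mathbb{T}^d}|D_{N_j}(x)|^2\,dx\;\le\; c\,N_j^{1-\frac{d+1}{d^2+d-1}}.$$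
   Context: $\Sigma_{d-1}$ is the unit sphere of $\mathbb{R}^d$. The torus $\mathbb{T}^d=\mathbb{R}^d/\mathbb{Z}^d$ is identified with the unit cube $[-\frac12,\frac12)^d$. For a bounded measurable set $\Omega\subset\mathbb{R}^d$, $\widehat{\chi_\Omega}(\xi)=\int_\Omega e^{-2\pi i\xi\cdot x}\,dx$, and $|\Omega|$ is its Lebesgue measure. For a finite sequence $z_1,\dots,z_N\in\mathbb{T}^d$ (repetitions allowed), $$D_N(x)=\sum_{j=1}^N\chi_{-x+\Omega}(z_j)-N|\Omega|,\qquad x\in\mathbb{T}^d,$$ where $-x+\Omega$ is regarded as a subset of $\mathbb{T}^d$, i.e. $\chi_{-x+\Omega}(z)=1$ iff $z+x\in\Omega$ modulo $\mathbb{Z}^d$. ''For all sufficiently large $\rho$ and every $\Theta$'' means the threshold on $\rho$ is independent of $\Theta$. *)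

(* Defs.v *)
From HB Require Import structures.
From mathcomp Require Import all_boot all_order all_algebra.
From mathcomp Require Import all_classical all_reals all_analysis.
From mathcomp Require Import complex.

Set Implicit Arguments.
Unset Strict Implicit.
Unset Printing Implicit Defensive.

Import Order.TTheory GRing.Theory Num.Theory.
Import numFieldNormedType.Exports.

Local Open Scope classical_set_scope.
Local Open Scope ring_scope.

(* Vectors of R^d are d-tuples of reals. The library has no d-dimensional
   Lebesgue measure: it is built here on the Borel sets of R^d as an iterated
   product of the one-dimensional one, then completed. *)

Section product_step.
Context (R : realType) (n : nat)
  (m : {sigma_finite_measure set (n.-tuple (measurableTypeR R)) -> \bar R}).

Let T := measurableTypeR R.
Let consT (p : T * n.-tuple T) : n.+1.-tuple T := [tuple of p.1 :: p.2].
Let leb1 : {sigma_finite_measure set T -> \bar R} := @lebesgue_measure R.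

Let measurable_consT : measurable_fun setT consT.
Proof. exact: measurable_cons. Qed.

Definition cons_lebesgue : set (n.+1.-tuple T) -> \bar R :=
  pushforward (leb1 \x m)%E consT.

Let cons_lebesgue0 : cons_lebesgue set0 = 0%E.
Proof. by rewrite /cons_lebesgue /pushforward preimage_set0 measure0. Qed.

Let cons_lebesgue_ge0 A : (0 <= cons_lebesgue A)%E.
Proof. exact: measure_ge0. Qed.

Let cons_lebesgue_sigma_additive : semi_sigma_additive cons_lebesgue.
Proof.
move=> F mF tF mUF; rewrite /cons_lebesgue /pushforward preimage_bigcup.
apply: measure_semi_sigma_additive.
- by move=> k; rewrite -[X in measurable X]setTI; exact: measurable_consT.
- apply/trivIsetP => /= i j _ _ ij; rewrite -preimage_setI.
  by move/trivIsetP : tF => /(_ _ _ _ _ ij) ->//; rewrite preimage_set0.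
- by rewrite -preimage_bigcup -[X in measurable X]setTI; exact: measurable_consT.
Qed.

HB.instance Definition _ := isMeasure.Build _ _ _ cons_lebesgue
  cons_lebesgue0 cons_lebesgue_ge0 cons_lebesgue_sigma_additive.

Let uncons (t : n.+1.-tuple T) : T * n.-tuple T := (thead t, [tuple of behead t]).

Let measurable_uncons : measurable_fun setT uncons.
Proof.
apply/measurable_fun_pairP; split => /=.
- exact: (measurable_tnth ord0).
- exact: measurable_behead.
Qed.

Let consTK : cancel consT uncons.
Proof.
by case=> x t; rewrite /uncons /consT /=; congr pair; exact: val_inj.
Qed.

Let cons_lebesgue_sigma_finite : sigma_finite setT cons_lebesgue.
Proof.
have /sigma_finiteP[F [FT ndF Foo]] := sigma_finiteT leb1.
have /sigma_finiteP[G [GT ndG Goo]] := sigma_finiteT m.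
exists (fun k => uncons @^-1` (F k `*` G k)).
  rewrite -preimage_bigcup (_ : \bigcup_k _ = setT) ?preimage_setT//.
  apply/seteqP; split => // -[x y] _.
  have [k _ Fkx] : (\bigcup_k F k) x by rewrite -FT.
  have [l _ Gly] : (\bigcup_k G k) y by rewrite -GT.
  exists (maxn k l) => //; split.
  - by move: Fkx; exact/subsetPset/ndF/leq_maxl.
  - by move: Gly; exact/subsetPset/ndG/leq_maxr.
move=> k; have [mF Fk] := Foo k; have [mG Gk] := Goo k; split.
  rewrite -[X in measurable X]setTI; apply: measurable_uncons => //.
  exact: measurableX.
rewrite /cons_lebesgue /pushforward -comp_preimage.
rewrite (_ : uncons \o consT = id); last by apply/funext => p; exact: consTK.
by rewrite preimage_id product_measure1E// lte_mul_pinfty// ge0_fin_numE.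
Qed.

HB.instance Definition _ := Measure_isSigmaFinite.Build _ _ _ cons_lebesgue
  cons_lebesgue_sigma_finite.

End product_step.

Fixpoint borel_lebesgue (R : realType) (d : nat) :
    {sigma_finite_measure set (d.-tuple (measurableTypeR R)) -> \bar R} :=
  match d with
  | 0 => \d_([tuple] : 0.-tuple (measurableTypeR R))
  | d'.+1 => cons_lebesgue (borel_lebesgue R d')
  end.

Lemma borel_lebesgue_box (R : realType) (d : nat)
    (A : 'I_d -> set (measurableTypeR R)) :
  (forall i, measurable (A i)) ->
  measurable [set x : d.-tuple (measurableTypeR R) | forall i, A i (tnth x i)] /\
  borel_lebesgue R d [set x | forall i, A i (tnth x i)] =
  (\prod_(i < d) lebesgue_measure (A i))%E.
Proof.
elim: d A => [|d IH] A mA.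
  have -> : [set x : 0.-tuple (measurableTypeR R) |
      forall i, A i (tnth x i)] = setT.
    by apply/seteqP; split => // x _ [].
  by split => //; rewrite big_ord0 /= diracE mem_set.
have [mB eB] := IH (fun i => A (lift ord0 i)) (fun i => mA _).
split.
  rewrite (_ : mkset _ = \bigcap_(i in setT)
      ((fun x : d.+1.-tuple (measurableTypeR R) => tnth x i) @^-1` A i)).
    apply: fin_bigcap_measurable => // i _.
    by rewrite -[X in measurable X]setTI; apply: measurable_tnth.
  by apply/seteqP; split => x /= h i; [move=> _; exact: h|exact: h].
rewrite big_ord_recl /= -eB /cons_lebesgue /pushforward -product_measure1E//.
congr product_measure1; apply/seteqP; split => -[x y] /= h.
  split; first exact: (h ord0).
  by move=> i; have := h (lift ord0 i); rewrite tnthS.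
move=> i; case: (unliftP ord0 i) => [j|] ->; last by case: h.
by rewrite tnthS; case: h.
Qed.

Section lebesgue.
Context (R : realType) (d : nat).
Implicit Types (Omega : set (d.-tuple R)) (x : d.-tuple R).

Definition lebesgue := @completed_measure_extension _ _ _ (borel_lebesgue R d).

HB.instance Definition _ := Measure.on lebesgue.

(* The Caratheodory sigma-algebra, on which [lebesgue] is a complete measure. *)
Definition lebesgue_measurable Omega : Prop :=
  ((borel_lebesgue R d)^*)%mu.-cara.-measurable Omega.

Definition dotp x y : R := \sum_(i < d) tnth x i * tnth y i.

Definition unit_sphere : set (d.-tuple R) :=
  [set x | Num.sqrt (dotp x x) = 1].

Definition scalev (a : R) x : d.-tuple R := [tuple a * tnth x i | i < d].

(* [-1/2, 1/2)^d, which is also the fundamental domain standing for the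
   torus. *)
Definition unit_cube : set (d.-tuple R) :=
  [set x | forall i, - 2^-1 <= tnth x i < 2^-1].

Definition expi (t : R) : R[i] := Complex (cos t) (sin t).

Definition complex_integral (D : set (d.-tuple R)) (f : d.-tuple R -> R[i]) :
    R[i] :=
  Complex (\int[lebesgue]_(x in D) complex.Re (f x))
          (\int[lebesgue]_(x in D) complex.Im (f x)).

Definition fourier_indic Omega (xi : d.-tuple R) : R[i] :=
  complex_integral Omega (fun x => expi (- (2 * pi * dotp xi x))).

(* The points of R^d whose class modulo Z^d lies in -x + Omega. *)
Definition torus_translate Omega x : set (d.-tuple R) :=
  [set z | exists2 w, Omega w &
    forall i, tnth z i + tnth x i - tnth w i \is a Num.int].

Definition discrepancy (N : nat) Omega (z : 'I_N -> d.-tuple R) x : R :=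
  \sum_(j < N) \1_(torus_translate Omega x) (z j)
  - N%:R * fine (lebesgue Omega).

End lebesgue.

Arguments lebesgue : clear implicits.
Arguments unit_cube : clear implicits.

(* Main.v *)
Require Import Defs.
From mathcomp Require Import all_boot all_order all_algebra.
From mathcomp Require Import all_classical all_reals all_analysis.
From mathcomp Require Import complex.
From mathcomp Require Import measurable_realfun lra ring zify.

(** The points form a finite subgroup of the torus whose dual lattice is adapted
    to the two rates of decay.

    If the N points form a subgroup, the exponential sum at a frequency m is N
    when m lies in the dual lattice L and 0 otherwise, so that by Parseval the
    mean square of the discrepancy is N^2 times the sum over nonzero m in L of
    |F(m)|^2, where F is the Fourier transform of the indicator of Omega. Let w
    be an integer vector in the cone of fast decay around v: it exists because
    rational directions are dense ([integer_direction]). With w fixed and T a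
    large integer, take

       L = { A (k w + q n) : k integer, n an integer vector },  q = T, A = T^d,

    of index N = A^d q^(d-1) = T^(d^2+d-1). Points of L on the line R w lie in
    the cone, and the nonzero ones have length at least A, hence contribute
    N^2 A^(-(d+2)) up to a constant ([on_line_sum]). The projection of Z^d along
    w is again a lattice, so every other point has length at least a constant
    times A q (1 + |n|) ([off_line_size]); for each n there are q values of k, so
    these points contribute N^2 q (A q)^(-(d+1)) ([off_line_sum]). Both
    quantities are N^2 T^(-d(d+2)) = N T^(-(d+1)), and T^(d+1) is N to the power
    (d+1)/(d^2+d-1).

    Of Parseval only the inequality bounding the integral by the sum of squared
    coefficients is needed, but this is the half that expresses completeness of
    the trigonometric system. On the circle it comes from the Fejer kernel: the
    associated quadratic form is an average of partial sums of squared
    coefficients ([fejer_form_le]), and it tends to the integral of u^2 because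
    the means of continuous functions converge and continuous functions are
    dense in L^1 ([parseval_circle_real]). In higher dimension it follows by
    integrating one coordinate at a time ([parseval_torus]).

    A translation of the torus multiplies each coefficient by a character, which
    separates the exponential sum from F ([discrepancy_coef]); the exponential
    sum over the points is a product of geometric sums, and it vanishes off L
    ([raw_point_dual]). Finally Omega is only Lebesgue measurable, and is replaced
    by a Borel set that differs from it by a null set ([ex_borel_model]); since
    translations preserve null sets, this changes the discrepancy on a null set
    only ([integral_discrepancy_le]). *)

Set Implicit Arguments.
Unset Strict Implicit.
Unset Printing Implicit Defensive.

Import Order.TTheory GRing.Theory Num.Theory.
Import numFieldNormedType.Exports.

Local Open Scope classical_set_scope.
Local Open Scope ring_scope.

(** * Bounded measurable functions on finite measure spaces *)

(** On a finite measure space these functions are integrable, and the class is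
    stable under sums, products and partial integrals, so that linearity and
    Fubini apply to it without integrability side conditions. *)
Definition bounded_measurable d (T : measurableType d) (R : realType)
    (f : T -> R) : Prop :=
  measurable_fun setT f /\ exists M, forall x, `|f x| <= M.

Section bounded_measurable_theory.
Context d (T : measurableType d) (R : realType).
Implicit Types f g : T -> R.

Lemma bm_cst (c : R) : bounded_measurable (fun _ : T => c).
Proof. by split; [exact: measurable_cst|exists `|c|]. Qed.

Lemma bmD f g : bounded_measurable f -> bounded_measurable g ->
  bounded_measurable (fun x => f x + g x).
Proof.
move=> [mf [M fM]] [mg [N gN]]; split; first exact: measurable_funD.
by exists (M + N) => x; apply: le_trans (ler_normD _ _) _; exact: lerD.
Qed.

Lemma bmM f g : bounded_measurable f -> bounded_measurable g ->
  bounded_measurable (fun x => f x * g x).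
Proof.
move=> [mf [M fM]] [mg [N gN]]; split; first exact: measurable_funM.
by exists (M * N) => x; rewrite normrM; exact: ler_pM.
Qed.

Lemma bmZ (c : R) f : bounded_measurable f ->
  bounded_measurable (fun x => c * f x).
Proof. by move=> bf; apply: bmM => //; exact: bm_cst. Qed.

Lemma bmN f : bounded_measurable f -> bounded_measurable (fun x => - f x).
Proof.
by move=> /(bmZ (-1)); congr bounded_measurable; apply/funext => x; rewrite mulN1r.
Qed.

Lemma bmB f g : bounded_measurable f -> bounded_measurable g ->
  bounded_measurable (fun x => f x - g x).
Proof. by move=> bf /bmN; exact: bmD. Qed.

Lemma bm_sum (I : Type) (r : seq I) (F : I -> T -> R) :
  (forall i, bounded_measurable (F i)) ->
  bounded_measurable (fun x => \sum_(i <- r) F i x).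
Proof.
move=> bF; elim: r => [|i r IH].
  by under eq_fun do rewrite big_nil; exact: bm_cst.
by under eq_fun do rewrite big_cons; exact: bmD.
Qed.

Lemma bm_norm f : bounded_measurable f -> bounded_measurable (fun x => `|f x|).
Proof.
move=> [mf [M fM]]; split; first exact: measurableT_comp.
by exists M => x; rewrite normr_id.
Qed.

Lemma bm_sqr f : bounded_measurable f -> bounded_measurable (fun x => f x ^+ 2).
Proof. by move=> bf; under eq_fun do rewrite expr2; exact: bmM. Qed.

Lemma bm_indic (A : set T) : measurable A -> bounded_measurable (\1_A : T -> R).
Proof.
move=> mA; split; first exact: measurable_indic.
by exists 1 => x; rewrite indicE; case: (_ \in _); rewrite /= ?normr1 ?normr0.
Qed.

Lemma bm_cos (f : T -> R) : measurable_fun setT f ->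
  bounded_measurable (fun x => cos (f x)).
Proof.
move=> mf; split; last by exists 1 => x; rewrite ler_norml cos_geN1 cos_le1.
apply: measurableT_comp => //.
by apply: continuous_measurable_fun; exact: continuous_cos.
Qed.

Lemma bm_sin (f : T -> R) : measurable_fun setT f ->
  bounded_measurable (fun x => sin (f x)).
Proof.
move=> mf; split; last by exists 1 => x; rewrite ler_norml sin_geN1 sin_le1.
apply: measurableT_comp => //.
by apply: continuous_measurable_fun; exact: continuous_sin.
Qed.

Lemma bm_comp d' (T' : measurableType d') (phi : T' -> T) f :
  measurable_fun setT phi -> bounded_measurable f ->
  bounded_measurable (fun x => f (phi x)).
Proof.
move=> mphi [mf [M fM]]; split; first exact: measurableT_comp.
by exists M.
Qed.

Lemma bm_integrable_lty (nu : {measure set T -> \bar R}) f :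
  (nu setT < +oo)%E -> bounded_measurable f -> nu.-integrable setT (EFin \o f).
Proof.
move=> nuT [mf [M fM]]; apply: measurable_bounded_integrable => //.
by exists M; split; [exact: num_real|move=> y My x _; exact: le_trans (fM x) (ltW My)].
Qed.

Variable mu : {finite_measure set T -> \bar R}.

Lemma bm_integrable f : bounded_measurable f ->
  mu.-integrable setT (EFin \o f).
Proof.
by apply: bm_integrable_lty; rewrite -ge0_fin_numE//; exact: fin_num_measure.
Qed.

Lemma bm_fin_num f : bounded_measurable f ->
  (\int[mu]_x (f x)%:E)%E \is a fin_num.
Proof. by move=> /bm_integrable; exact: integrable_fin_num. Qed.

Lemma EFin_bmint f : bounded_measurable f ->
  ((\int[mu]_x f x)%:E = \int[mu]_x (f x)%:E)%E.
Proof. by move=> /bm_fin_num h; rewrite /Rintegral fineK. Qed.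

Lemma bmintD f g : bounded_measurable f -> bounded_measurable g ->
  \int[mu]_x (f x + g x) = \int[mu]_x f x + \int[mu]_x g x.
Proof. by move=> bf bg; rewrite RintegralD//; exact: bm_integrable. Qed.

Lemma bmintB f g : bounded_measurable f -> bounded_measurable g ->
  \int[mu]_x (f x - g x) = \int[mu]_x f x - \int[mu]_x g x.
Proof. by move=> bf bg; rewrite RintegralB//; exact: bm_integrable. Qed.

Lemma bmintZ c f : bounded_measurable f ->
  \int[mu]_x (c * f x) = c * \int[mu]_x f x.
Proof. by move=> bf; rewrite RintegralZl//; exact: bm_integrable. Qed.

Lemma bmintZr c f : bounded_measurable f ->
  \int[mu]_x (f x * c) = (\int[mu]_x f x) * c.
Proof. by move=> bf; rewrite RintegralZr//; exact: bm_integrable. Qed.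

Lemma bmint_sum (I : Type) (r : seq I) (F : I -> T -> R) :
  (forall i, bounded_measurable (F i)) ->
  \int[mu]_x (\sum_(i <- r) F i x) = \sum_(i <- r) \int[mu]_x F i x.
Proof.
move=> bF; elim: r => [|i r IH].
  rewrite big_nil; under eq_Rintegral do rewrite big_nil.
  by rewrite Rintegral_cst// mul0r.
under eq_Rintegral do rewrite big_cons.
by rewrite big_cons bmintD ?IH//; exact: bm_sum.
Qed.

Lemma le_bmint f g : bounded_measurable f -> bounded_measurable g ->
  (forall x, f x <= g x) -> \int[mu]_x f x <= \int[mu]_x g x.
Proof. by move=> bf bg fg; apply: le_Rintegral => //; exact: bm_integrable. Qed.

Lemma bmint_norm f : bounded_measurable f ->
  `|\int[mu]_x f x| <= \int[mu]_x `|f x|.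
Proof. by move=> bf; apply: le_normr_Rintegral => //; exact: bm_integrable. Qed.

Lemma bmint_bound f M : bounded_measurable f -> (forall x, `|f x| <= M) ->
  `|\int[mu]_x f x| <= M * fine (mu setT).
Proof.
move=> bf fM; apply: le_trans (bmint_norm bf) _.
rewrite -(@Rintegral_cst _ _ _ mu setT measurableT M).
by apply: le_bmint => //; [exact: bm_norm|exact: bm_cst].
Qed.

End bounded_measurable_theory.

Section bounded_fubini.
Context d1 d2 (T1 : measurableType d1) (T2 : measurableType d2) (R : realType).
Variables (m1 : {finite_measure set T1 -> \bar R})
  (m2 : {finite_measure set T2 -> \bar R}).

Lemma bm_integrable_prod (f : T1 * T2 -> R) : bounded_measurable f ->
  (m1 \x m2)%E.-integrable setT (EFin \o f).
Proof.
apply: bm_integrable_lty; rewrite /= -setXTT product_measure1E//.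
by rewrite lte_mul_pinfty// ?fin_num_measure// -ge0_fin_numE// fin_num_measure.
Qed.

Lemma bm_pair1 (f : T1 * T2 -> R) y : bounded_measurable f ->
  bounded_measurable (fun x => f (x, y)).
Proof.
move=> bf; apply: (bm_comp (phi := fun x => (x, y))) bf.
exact: pair2_measurable.
Qed.

Lemma bm_partial1 (f : T1 * T2 -> R) : bounded_measurable f ->
  bounded_measurable (fun y => \int[m1]_x f (x, y)).
Proof.
move=> bf; split.
  apply: measurableT_comp => //.
  have /= := @measurable_fubini_G _ _ _ _ _ m1 m2 (EFin \o f).
  by apply; exact: bm_integrable_prod.
have [_ [M fM]] := bf; exists (M * fine (m1 setT)) => x.
by apply: bmint_bound => //; exact: bm_pair1.
Qed.

Lemma bmint_prod21 (f : T1 * T2 -> R) : bounded_measurable f ->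
  \int[(m1 \x m2)%E]_z f z = \int[m2]_y \int[m1]_x f (x, y).
Proof.
move=> bf; rewrite /Rintegral; congr fine.
rewrite -(@integral21_prod_meas1 _ _ _ _ _ m1 m2 (EFin \o f)); last first.
  exact: bm_integrable_prod.
apply: eq_integral => x _ /=; rewrite /fubini_G fineK//.
by apply: bm_fin_num; exact: bm_pair1.
Qed.

End bounded_fubini.

Section null_sets.
Context d (T : measurableType d) (R : realType).
Variable mu : {finite_measure set T -> \bar R}.
Variable N : set T.
Hypotheses (mN : measurable N) (muN : mu N = 0%E).

Lemma bmint_off_null (f : T -> R) : bounded_measurable f ->
  \int[mu]_x f x = \int[mu]_(x in ~` N) f x.
Proof.
move=> bf; rewrite /Rintegral (negligible_integral mN) ?setTD//.
exact: bm_integrable.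
Qed.

Lemma bm_integrableS (f : T -> R) D : measurable D -> bounded_measurable f ->
  mu.-integrable D (EFin \o f).
Proof. by move=> mD /(bm_integrable mu); exact: integrableS. Qed.

Lemma le_bmint_off_null (f g : T -> R) : bounded_measurable f ->
  bounded_measurable g -> (forall x, ~ N x -> f x <= g x) ->
  \int[mu]_x f x <= \int[mu]_x g x.
Proof.
move=> bf bg fg; rewrite !bmint_off_null//; apply: le_Rintegral => //.
- exact: measurableC.
- by apply: bm_integrableS => //; exact: measurableC.
- by apply: bm_integrableS => //; exact: measurableC.
Qed.

(** Dominated convergence, the dominating function being the constant M. *)
Lemma bmint_cvg0 (f : nat -> T -> R) (M : R) :
  (forall n, bounded_measurable (f n)) -> (forall n x, `|f n x| <= M) ->
  (forall x, ~ N x -> f n x @[n --> \oo] --> 0) ->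
  \int[mu]_x f n x @[n --> \oo] --> 0.
Proof.
move=> bf fM f0.
have mCN := measurableC mN.
have mf n : measurable_fun (~` N) (EFin \o f n).
  exact: measurable_int (bm_integrableS mCN (bf n)).
have cf : {ae mu, forall x, (~` N) x -> (EFin \o f n) x @[n --> \oo] --> 0%E}.
  by apply: aeW => x Nx; apply: cvg_EFin; [exact: nearW|exact: f0].
have bd : {ae mu, forall x n, (~` N) x -> (`|(EFin \o f n) x| <= (cst M%:E) x)%E}.
  by apply: aeW => x n _; rewrite /= lee_fin.
have iM : mu.-integrable (~` N) (cst M%:E).
  exact: (@bm_integrableS (fun=> M) _ mCN (bm_cst _ M)).
have [_ _] := dominated_convergence mCN mf (measurable_cst _) cf iM bd.
rewrite integral0 => /fine_cvg /= h.
by under eq_fun do rewrite bmint_off_null//; exact: h.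
Qed.

End null_sets.

(** * Sums of nonnegative families *)

Section esum_extra.
Context (R : realType).
Local Open Scope ereal_scope.

Lemma esum_subset (T : choiceType) (A B : set T) (a : T -> \bar R) :
  (forall x, 0 <= a x) -> A `<=` B ->
  \esum_(x in A) a x <= \esum_(x in B) a x.
Proof.
move=> a0 AB; apply: ge_ereal_sup => _ [X [finX XA] <-].
apply: esum_ge; exists X => //; split => //.
exact: subset_trans AB.
Qed.

Lemma esum_inj_le (T1 T2 : choiceType) (P : set T1) (phi : T1 -> T2)
    (a : T2 -> \bar R) : (forall x, 0 <= a x) -> set_inj P phi ->
  \esum_(x in P) a (phi x) <= \esum_(y in setT) a y.
Proof. by move=> a0 inj; rewrite -esum_image//; exact: esum_subset. Qed.

Lemma esum_finType (I : finType) (a : I -> \bar R) : (forall i, 0 <= a i) ->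
  \esum_(i in setT) a i = \sum_i a i.
Proof.
move=> a0; rewrite esum_fset//; last exact: finite_finset.
have -> : [set: I] = [set` index_enum I].
  by apply/seteqP; split => // i _ /=; rewrite mem_index_enum.
by rewrite -fsbig_seq// index_enum_uniq.
Qed.

End esum_extra.

Lemma esumZ_le (R : realType) (T : choiceType) (S : set T) (c : R)
    (g : T -> \bar R) :
  0 <= c ->
  (forall x, 0 <= g x)%E ->
  (\esum_(x in S) (c%:E * g x) <= c%:E * \esum_(x in S) g x)%E.
Proof.
move=> c0 g0; apply: ge_ereal_sup => _ [X [finX XS] <-].
rewrite -ge0_mule_fsumr//; apply: lee_wpmul2l; first by rewrite lee_fin.
by apply: ereal_sup_ubound; exists X.
Qed.

(** Comparison of two sums through a change of index; only the indices of
    nonzero terms have to be followed. *)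
Lemma esum_le_via (R : realType) (T1 T2 : choiceType) (P : set T1) (f : T1 -> \bar R)
    (phi : T1 -> T2) (h : T2 -> \bar R) :
  (forall x, 0 <= f x)%E -> (forall y, 0 <= h y)%E ->
  (forall x, P x -> f x != 0%E -> f x <= h (phi x))%E ->
  (forall x y, P x -> P y -> f x != 0%E -> f y != 0%E -> phi x = phi y -> x = y) ->
  (\esum_(x in P) f x <= \esum_(y in [set: T2]) h y)%E.
Proof.
move=> f0 h0 fh inj.
rewrite (esumID [set x | f x != 0%E]); last by move=> x _; exact: f0.
rewrite [X in (_ + X)%E]esum1 ?adde0; last first.
  by move=> x [_ /=]; case: eqVneq.
apply: (@le_trans _ _ (\esum_(x in P `&` [set x | f x != 0%E]) h (phi x))%E).
  by apply: le_esum => x [Px fx]; exact: fh.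
apply: esum_inj_le => // x y /set_mem[Px fx] /set_mem[Py fy].
exact: inj.
Qed.

Section esum_int.

(** Enumerating the integers turns sums over them into series, to which monotone
    convergence applies. *)
Definition int_of_nat (n : nat) : int := if odd n then Negz n./2 else Posz n./2.
Definition nat_of_int (k : int) : nat :=
  match k with Posz m => m.*2 | Negz m => m.*2.+1 end.

Lemma int_of_natK : cancel int_of_nat nat_of_int.
Proof.
move=> n; rewrite /int_of_nat; have := odd_double_half n.
by case: (odd n) => /= E; rewrite -[RHS]E ?add1n ?add0n.
Qed.

Lemma nat_of_intK : cancel nat_of_int int_of_nat.
Proof. by case=> m; rewrite /int_of_nat /= odd_double ?uphalf_double// doubleK. Qed.

Lemma int_of_nat_bij : set_bij [set: nat] [set: int] int_of_nat.
Proof.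
rewrite setTT_bijective; exists nat_of_int; [exact: int_of_natK|exact: nat_of_intK].
Qed.

Context d (T : measurableType d) (R : realType) (mu : {measure set T -> \bar R}).
Variable f : int -> T -> \bar R.
Hypotheses (f0 : forall k x, (0 <= f k x)%E) (mf : forall k, measurable_fun setT (f k)).

Lemma esum_int_nneseries x :
  (\esum_(k in [set: int]) f k x = \sum_(n <oo) f (int_of_nat n) x)%E.
Proof. by rewrite (reindex_esum _ _ _ _ int_of_nat_bij) nneseries_esumT. Qed.

Lemma measurable_esum_int :
  measurable_fun setT (fun x => \esum_(k in [set: int]) f k x)%E.
Proof.
under eq_fun do rewrite esum_int_nneseries.
by apply: (@ge0_emeasurable_sum _ _ _ _ _ xpredT).
Qed.

Lemma integral_esum_int :
  ((\int[mu]_x \esum_(k in [set: int]) f k x) =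
   \esum_(k in [set: int]) \int[mu]_x f k x)%E.
Proof.
under eq_integral do rewrite esum_int_nneseries.
rewrite integral_nneseries//.
rewrite nneseries_esumT; last by move=> n; apply: integral_ge0.
by rewrite (reindex_esum _ _ _ _ int_of_nat_bij).
Qed.

End esum_int.

(** * The torus as a measure space *)

Section torus.
Context (R : realType).
Local Notation T := (measurableTypeR R).

Definition unit_interval : set T := `[- 2^-1, 2^-1[%classic.

Lemma measurable_unit_interval : measurable unit_interval.
Proof. exact: measurable_itv. Qed.

Lemma lebesgue_unit_interval : lebesgue_measure unit_interval = 1%E.
Proof.
rewrite lebesgue_measure_itv/= lte_fin ifT.
  by rewrite -EFinD opprK -div1r -splitr.
by rewrite (@lt_trans _ _ 0)// ?oppr_lt0 invr_gt0.
Qed.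

Let lebesgue_unit_interval_lty : (lebesgue_measure unit_interval < +oo)%E.
Proof. by rewrite lebesgue_unit_interval ltry. Qed.

(** A function on the torus is handled through its values on the fundamental
    domain, which carries the restriction of Lebesgue measure. *)
Definition circle : {finite_measure set T -> \bar R} :=
  mfrestr measurable_unit_interval lebesgue_unit_interval_lty.

Lemma circle_setT : circle setT = 1%E.
Proof. by rewrite /circle /= /mfrestr/= /mrestr setTI; exact: lebesgue_unit_interval. Qed.

Lemma unit_cube_box d : unit_cube R d = [set x | forall i, unit_interval (tnth x i)].
Proof.
by apply/seteqP; split => x /= h i; have := h i; rewrite /unit_interval /= in_itv.
Qed.

Lemma measurable_unit_cube d : measurable (unit_cube R d : set (d.-tuple T)).
Proof.
rewrite unit_cube_box.
by case: (borel_lebesgue_box (fun i : 'I_d => measurable_unit_interval)).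
Qed.

Lemma borel_lebesgue_unit_cube d : borel_lebesgue R d (unit_cube R d) = 1%E.
Proof.
rewrite unit_cube_box.
case: (borel_lebesgue_box (fun i : 'I_d => measurable_unit_interval)) => _ ->.
by rewrite big1// => i _; exact: lebesgue_unit_interval.
Qed.

Let unit_cube_lty d : (borel_lebesgue R d (unit_cube R d) < +oo)%E.
Proof. by rewrite borel_lebesgue_unit_cube ltry. Qed.

Definition torus d : {finite_measure set (d.-tuple T) -> \bar R} :=
  mfrestr (@measurable_unit_cube d) (@unit_cube_lty d).

Lemma torusE d (A : set (d.-tuple T)) :
  torus d A = borel_lebesgue R d (A `&` unit_cube R d).
Proof. by []. Qed.

Lemma torus_setT d : torus d setT = 1%E.
Proof. by rewrite torusE setTI borel_lebesgue_unit_cube. Qed.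

Definition cons_pair d (p : T * d.-tuple T) : d.+1.-tuple T := [tuple of p.1 :: p.2].
Definition uncons d (t : d.+1.-tuple T) : T * d.-tuple T :=
  (thead t, [tuple of behead t]).

Lemma measurable_cons_pair d : measurable_fun setT (@cons_pair d).
Proof. exact: measurable_cons. Qed.

Lemma measurable_uncons d : measurable_fun setT (@uncons d).
Proof.
apply/measurable_fun_pairP; split => /=.
- exact: (measurable_tnth ord0).
- exact: measurable_behead.
Qed.

Lemma cons_pairK d : cancel (@cons_pair d) (@uncons d).
Proof. by case=> x t; congr pair; exact: val_inj. Qed.

Lemma unconsK d : cancel (@uncons d) (@cons_pair d).
Proof. by move=> t; rewrite /cons_pair /uncons /= [RHS]tuple_eta. Qed.

Lemma unit_cube_cons d (x : T) (y : d.-tuple T) :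
  unit_cube R d.+1 (cons_pair (x, y)) <-> unit_interval x /\ unit_cube R d y.
Proof.
rewrite !unit_cube_box /=; split => [h|[hx hy] i].
  split; first exact: (h ord0).
  by move=> i; have := h (lift ord0 i); rewrite tnthS.
by case: (unliftP ord0 i) => [j|] ->//; rewrite tnthS.
Qed.

(** A product measure is determined by its values on boxes, and the cube in
    dimension d + 1 is a box over the cube in dimension d. *)
Lemma torus_cons d (A : set (d.+1.-tuple T)) : measurable A ->
  torus d.+1 A = pushforward (circle \x torus d)%E (@cons_pair d) A.
Proof.
move=> mA; rewrite /pushforward.
have muncons := @measurable_uncons d.
have mcons := @measurable_cons_pair d.
have mm : measurable (@cons_pair d @^-1` A).
  by rewrite -[X in measurable X]setTI; exact: mcons.
have key : forall B C, measurable B -> measurable C ->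
   pushforward (torus d.+1) (@uncons d) (B `*` C) = (circle B * torus d C)%E.
  move=> B C mB mC.
  rewrite /pushforward torusE /= /cons_lebesgue /pushforward.
  rewrite (_ : _ @^-1` _ = (B `&` unit_interval) `*` (C `&` unit_cube R d)).
    rewrite product_measure1E//.
    - exact: measurableI (measurable_unit_interval).
    - exact: measurableI (@measurable_unit_cube d).
  apply/seteqP; split => -[x y].
  - move=> [h /unit_cube_cons [xi yc]].
    have {h} : (B `*` C) (uncons (cons_pair (x, y))) by [].
    by rewrite cons_pairK => -[Bx Cy].
  - move=> [[Bx xi] [Cy yc]]; split; last exact/unit_cube_cons.
    suff : (B `*` C) (uncons (cons_pair (x, y))) by [].
    by rewrite cons_pairK.
transitivity (pushforward (torus d.+1) (@uncons d) (@cons_pair d @^-1` A)).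
  rewrite /pushforward -comp_preimage (_ : _ \o _ = id) ?preimage_id//.
  by apply/funext => x /=; exact: unconsK.
apply/esym; exact: (product_measure_unique (m' := pushforward _ _) key).
Qed.

Lemma bm_cons d (f : d.+1.-tuple T -> R) : bounded_measurable f ->
  bounded_measurable (f \o @cons_pair d).
Proof. by apply: bm_comp; exact: measurable_cons_pair. Qed.

Lemma bmint_torus_cons_prod d (f : d.+1.-tuple T -> R) : bounded_measurable f ->
  \int[torus d.+1]_x f x = \int[(circle \x torus d)%E]_p f (cons_pair p).
Proof.
move=> bf; rewrite /Rintegral; congr fine.
have mf : measurable_fun setT (EFin \o f) by apply/measurable_EFinP; case: bf.
have := integral_pushforward (@measurable_cons_pair d) (D := setT)
  (mu := (circle \x torus d)%E) mf _ measurableT.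
rewrite preimage_setT => /(_ (bm_integrable_prod _ _ (bm_cons bf))) <-.
apply: eq_measure_integral; first exact: measurable_cons_pair.
by move=> mc A mA _; exact: torus_cons.
Qed.

Lemma bmint_torus_cons d (f : d.+1.-tuple T -> R) : bounded_measurable f ->
  \int[torus d.+1]_x f x = \int[torus d]_y \int[circle]_t f (cons_pair (t, y)).
Proof.
move=> bf; rewrite bmint_torus_cons_prod//.
exact: (bmint_prod21 circle (torus d) (bm_cons bf)).
Qed.

Lemma bmint_torus0 (f : 0.-tuple T -> R) : bounded_measurable f ->
  \int[torus 0]_x f x = f [tuple].
Proof.
move=> bf; rewrite (_ : f = fun => f [tuple]); last by apply/funext => x; rewrite tuple0.
rewrite Rintegral_cst//.
rewrite [X in fine X](_ : _ = 1%E); first by rewrite mulr1.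
exact: torus_setT.
Qed.

End torus.

Section fold.
Context (R : realType).
Local Notation T := (measurableTypeR R).

(** The representative in [-1/2, 1/2) of the class of t modulo 1. *)
Definition fold1 (t : R) : R := t - (Num.floor (t + 2^-1))%:~R.

Lemma fold1_itv t : - 2^-1 <= fold1 t < 2^-1.
Proof.
rewrite /fold1; have := Num.Theory.floor_itv (t + 2^-1).
by rewrite intrD1 => /andP[h1 h2]; apply/andP; split; lra.
Qed.

Lemma fold1_unique t (k : int) :
  - 2^-1 <= t - k%:~R < 2^-1 -> fold1 t = t - k%:~R.
Proof.
move=> /andP[h1 h2]; rewrite /fold1; congr (_ - _%:~R).
by apply: Num.Theory.floor_def; rewrite intrD1; apply/andP; split; lra.
Qed.

Lemma fold1_int t : t - fold1 t \is a Num.int.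
Proof. by rewrite /fold1 opprB addrC subrK; exact: intr_int. Qed.

Lemma measurable_fold1 : measurable_fun setT (fold1 : T -> T).
Proof.
apply: measurable_funB => //; apply: nondecreasing_measurable => // x y xy.
by rewrite ler_int; apply: Num.Theory.le_floor; lra.
Qed.

Lemma lebesgue_shift (c : R) (A : set T) : measurable A ->
  lebesgue_measure ((fun x : T => x + c) @^-1` A) = lebesgue_measure A :> \bar R.
Proof.
move=> mA.
have mc : measurable_fun setT (fun x : T => x + c : T).
  exact: measurable_funD.
apply/esym; rewrite -[RHS]/(pushforward lebesgue_measure (fun x : T => x + c) A).
apply: (lebesgue_measure_unique (mu := pushforward lebesgue_measure _)) => //.
move=> X /ocitvP[->|[[a b] /= ab ->]]; first by rewrite !measure0.
rewrite /pushforward.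
rewrite (_ : _ @^-1` _ = `]a - c, b - c]%classic); last first.
  apply/seteqP; split => x /=; rewrite !in_itv/= => /andP[h1 h2]; apply/andP; split; lra.
rewrite !lebesgue_measure_itv/= !lte_fin ltrD2r ab.
by rewrite -!EFinD; congr EFin; lra.
Qed.

(** Translation by z followed by folding cuts the interval at one point and
    exchanges the two pieces, each of them being translated. *)
Lemma circle_shift (z : R) (A : set T) : measurable A ->
  circle R ((fun t => fold1 (t + z)) @^-1` A) = circle R A.
Proof.
move=> mA.
rewrite /circle /= /mfrestr /mrestr.
set f := z - (Num.floor z)%:~R.
have f01 : 0 <= f < 1.
  have := Num.Theory.floor_itv z; rewrite intrD1 /f => /andP[h1 h2].
  by apply/andP; split; lra.
have [f0 f1] := andP f01.
pose A1 := A `&` `[- 2^-1 + f, 2^-1[%classic.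
pose A2 := A `&` `[- 2^-1, - 2^-1 + f[%classic.
have mA1 : measurable (A1 : set T) by apply: measurableI => //; exact: measurable_itv.
have mA2 : measurable (A2 : set T) by apply: measurableI => //; exact: measurable_itv.
have mS c : measurable_fun setT (fun x : T => x + c : T) by exact: measurable_funD.
have mP c B : measurable (B : set T) -> measurable ((fun x : T => x + c : T) @^-1` B).
  by move=> mB; rewrite -[X in measurable X]setTI; exact: mS.
transitivity (lebesgue_measure (A1 : set T) + lebesgue_measure (A2 : set T))%E; last first.
  rewrite -measureU//; last first.
    rewrite -subset0 => x [[_ /=]]; rewrite in_itv/= => /andP[h _] [_ /=].
    by rewrite in_itv/= => /andP[_]; rewrite ltNge h.
  congr lebesgue_measure; apply/seteqP; split => x.
    rewrite /unit_interval.
    move=> [] [Ax]; rewrite /= in_itv/= => /andP[h1 h2]; split => //=; rewrite in_itv/=;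
      apply/andP; split; lra.
  move=> [Ax]; rewrite /unit_interval /= in_itv/= => /andP[h1 h2].
  have [xf|xf] := ltP x (- 2^-1 + f); [right|left]; split => //=; rewrite in_itv/=.
    by rewrite h1.
  by rewrite h2 xf.
rewrite -(lebesgue_shift f mA1) -(lebesgue_shift (f - 1) mA2).
rewrite -measureU; [|exact: mP|exact: mP|]; last first.
  rewrite -subset0 => x [[_ /=]]; rewrite in_itv/= => /andP[h h'] [_ /=].
  by rewrite in_itv/= => /andP[]; lra.
congr lebesgue_measure; apply/seteqP; split => x.
  move=> [/= Ax]; rewrite /unit_interval /= in_itv/= => /andP[h1 h2].
  have [xf|xf] := ltP x (2^-1 - f); [left|right].
    have E : fold1 (x + z) = x + f.
      rewrite (@fold1_unique _ (Num.floor z)); first by rewrite /f; lra.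
      by rewrite -/f; apply/andP; split; rewrite -addrA -/f; lra.
    by split; [rewrite -E|rewrite /= in_itv/=; apply/andP; split; lra].
  have E : fold1 (x + z) = x + (f - 1).
    rewrite (@fold1_unique _ (Num.floor z + 1)); first by rewrite intrD1 /f; lra.
    rewrite intrD1 (_ : _ - _ = x + (f - 1)); last by rewrite /f; lra.
    by apply/andP; split; lra.
  by split; [rewrite -E|rewrite /= in_itv/=; apply/andP; split; lra].
move=> [] [Ax]; rewrite /= in_itv/= => /andP[h1 h2].
  have E : fold1 (x + z) = x + f.
    rewrite (@fold1_unique _ (Num.floor z)); first by rewrite /f; lra.
    by rewrite -addrA -/f; apply/andP; split; lra.
  split; first by rewrite /= E.
  by rewrite /unit_interval /= in_itv/=; apply/andP; split; lra.
have E : fold1 (x + z) = x + (f - 1).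
  rewrite (@fold1_unique _ (Num.floor z + 1)); first by rewrite intrD1 /f; lra.
  rewrite intrD1 (_ : _ - _ = x + (f - 1)); last by rewrite /f; lra.
  by apply/andP; split; lra.
split; first by rewrite /= E.
by rewrite /unit_interval /= in_itv/=; apply/andP; split; lra.
Qed.

Definition fold_shift d (z x : d.-tuple R) : d.-tuple R :=
  [tuple fold1 (tnth x i + tnth z i) | i < d].

Lemma measurable_fold_shift d (z : d.-tuple R) :
  measurable_fun setT (fold_shift z : d.-tuple T -> d.-tuple T).
Proof.
apply/measurable_fun_tnthP => i.
rewrite (_ : _ \o _ = fun x : d.-tuple T => fold1 (tnth x i + tnth z i)); last first.
  by apply/funext => x /=; rewrite tnth_mktuple.
apply: (measurableT_comp measurable_fold1).
by apply: measurable_funD => //; exact: measurable_tnth.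
Qed.

Lemma unit_cube_fold_shift d (z x : d.-tuple R) : unit_cube R d (fold_shift z x).
Proof. by move=> i; rewrite tnth_mktuple; exact: fold1_itv. Qed.

Lemma fold_shift_cons d (z0 : R) (z : d.-tuple R) (x0 : R) (x : d.-tuple R) :
  fold_shift (cons_pair (z0, z)) (cons_pair (x0, x)) =
  cons_pair (fold1 (x0 + z0), fold_shift z x).
Proof.
apply: eq_from_tnth => i; rewrite tnth_mktuple.
by case: (unliftP ord0 i) => [j|] ->; rewrite /cons_pair ?tnth0 // !tnthS tnth_mktuple.
Qed.

(** The map acts on the coordinates separately, so by uniqueness of product
    measures it suffices to look at boxes. *)
Lemma torus_shift d (z : d.-tuple R) (A : set (d.-tuple T)) : measurable A ->
  torus R d (fold_shift z @^-1` A) = torus R d A.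
Proof.
elim: d => [|d IH] in z A *.
  move=> _; rewrite (_ : fold_shift z = id) ?preimage_id//.
  by apply/funext => x; rewrite [LHS]tuple0 [RHS]tuple0.
rewrite -[z]unconsK; case: (uncons z) => z0 {}z mA.
have mfs (n : nat) (w : n.-tuple R) (B : set (n.-tuple T)) : measurable B ->
    measurable (fold_shift w @^-1` B).
  by move=> mB; rewrite -[X in measurable X]setTI; exact: measurable_fold_shift.
rewrite !torus_cons//; last exact: mfs.
rewrite /pushforward.
pose phi (p : T * d.-tuple T) : T * d.-tuple T :=
  (fold1 (p.1 + z0), fold_shift z p.2).
have mphi1 : measurable_fun setT (fun t : T => fold1 (t + z0) : T).
  by apply: (measurableT_comp measurable_fold1); exact: measurable_funD.
have mphi : measurable_fun setT phi.
  apply/measurable_fun_pairP; split.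
    by apply: (measurableT_comp mphi1); exact: measurable_fst.
  by apply: (measurableT_comp (measurable_fold_shift z)); exact: measurable_snd.
have -> : @cons_pair R d @^-1` (fold_shift (cons_pair (z0, z)) @^-1` A) =
    phi @^-1` (@cons_pair R d @^-1` A).
  by apply/seteqP; split => -[x y]; rewrite /preimage /= fold_shift_cons.
have mm : measurable (@cons_pair R d @^-1` A).
  by rewrite -[X in measurable X]setTI; exact: measurable_cons_pair.
apply/esym; apply: (product_measure_unique (m' := pushforward _ phi)) => //.
move=> B C mB mC /=; rewrite /pushforward.
have -> : phi @^-1` (B `*` C) =
  ((fun t : T => fold1 (t + z0)) @^-1` B) `*` (fold_shift z @^-1` C) by [].
transitivity (circle R ((fun t : T => fold1 (t + z0)) @^-1` B) *
              torus R d (fold_shift z @^-1` C))%E.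
  apply: product_measure1E; last exact: mfs.
  by rewrite -[X in measurable X]setTI; exact: mphi1.
by rewrite circle_shift// IH.
Qed.

Lemma bm_fold_shift d (z : d.-tuple R) (f : d.-tuple T -> R) :
  bounded_measurable f -> bounded_measurable (fun x => f (fold_shift z x)).
Proof. by apply: bm_comp; exact: measurable_fold_shift. Qed.

Lemma bmint_fold_shift d (z : d.-tuple R) (f : d.-tuple T -> R) :
  bounded_measurable f ->
  \int[torus R d]_x f (fold_shift z x) = \int[torus R d]_x f x.
Proof.
move=> bf; rewrite /Rintegral; congr fine.
have mf : measurable_fun setT (EFin \o f) by apply/measurable_EFinP; case: bf.
have := integral_pushforward (@measurable_fold_shift d z) (D := setT)
  (mu := torus R d) mf _ measurableT.
rewrite preimage_setT => /(_ (bm_integrable (torus R d) (bm_fold_shift z bf))) <-.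
apply: eq_measure_integral; first exact: measurable_fold_shift.
by move=> mc A mA _; exact: torus_shift.
Qed.

Lemma bmint_fold1 (z : R) (f : T -> R) :
  bounded_measurable f ->
  \int[circle R]_x f (fold1 (x + z)) = \int[circle R]_x f x.
Proof.
move=> bf; rewrite /Rintegral; congr fine.
have mf : measurable_fun setT (EFin \o f) by apply/measurable_EFinP; case: bf.
have mphi1 : measurable_fun setT (fun t : T => fold1 (t + z) : T).
  by apply: (measurableT_comp measurable_fold1); exact: measurable_funD.
have := integral_pushforward mphi1 (D := setT)
  (mu := circle R) mf _ measurableT.
rewrite preimage_setT => /(_ (bm_integrable (circle R) (bm_comp mphi1 bf))) <-.
by apply: eq_measure_integral => A mA _; exact: circle_shift.
Qed.

End fold.

(** * Cosine and sine of period one *)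

Section trigo.
Context (R : realType).
Implicit Types (x : R) (k : int).

(** The factor 2 pi makes integers periods, so the characters of the torus are
    obtained from linear forms with integer coefficients. *)
Definition ecos (t : R) := cos (2 * pi * t).
Definition esin (t : R) := sin (2 * pi * t).

Lemma ecosD s t : ecos (s + t) = ecos s * ecos t - esin s * esin t.
Proof. by rewrite /ecos mulrDr cosD. Qed.
Lemma esinD s t : esin (s + t) = esin s * ecos t + ecos s * esin t.
Proof. by rewrite /esin mulrDr sinD. Qed.
Lemma ecosN t : ecos (- t) = ecos t.
Proof. by rewrite /ecos mulrN cosN. Qed.
Lemma esinN t : esin (- t) = - esin t.
Proof. by rewrite /esin mulrN sinN. Qed.
Lemma ecosB s t : ecos (s - t) = ecos s * ecos t + esin s * esin t.
Proof. by rewrite ecosD ecosN esinN mulrN opprK. Qed.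
Lemma esinB s t : esin (s - t) = esin s * ecos t - ecos s * esin t.
Proof. by rewrite esinD ecosN esinN mulrN. Qed.
Lemma ecos0 : ecos 0 = 1. Proof. by rewrite /ecos mulr0 cos0. Qed.
Lemma esin0 : esin 0 = 0. Proof. by rewrite /esin mulr0 sin0. Qed.
Lemma ecos2Desin2 t : ecos t ^+ 2 + esin t ^+ 2 = 1.
Proof. exact: cos2Dsin2. Qed.
Lemma ecos_max t : `|ecos t| <= 1. Proof. exact: cos_max. Qed.

Lemma ecos_nat (n : nat) : ecos n%:R = 1.
Proof.
rewrite /ecos (_ : 2 * pi * n%:R = 0 + (pi *+ 2) *+ n); last first.
  by rewrite add0r -mulr_natr mulr2n; ring.
by rewrite periodicn ?cos0//; exact: cosD2pi.
Qed.

Lemma ecos_int k : ecos k%:~R = 1.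
Proof. by case: k => n; rewrite ?NegzE ?mulrNz ?ecosN ecos_nat. Qed.

Lemma esin_int k : esin k%:~R = 0.
Proof.
have := ecos2Desin2 k%:~R; rewrite ecos_int expr1n -[RHS]addr0 => /addrI/eqP.
by rewrite sqrf_eq0 => /eqP.
Qed.

Lemma ecosDint t k : ecos (t + k%:~R) = ecos t.
Proof. by rewrite ecosD ecos_int esin_int; ring. Qed.
Lemma esinDint t k : esin (t + k%:~R) = esin t.
Proof. by rewrite esinD ecos_int esin_int; ring. Qed.

Lemma ecos_half : ecos 2^-1 = -1.
Proof. by rewrite /ecos mulrAC mulfV// mul1r cospi. Qed.
Lemma esin_half : esin 2^-1 = 0.
Proof. by rewrite /esin mulrAC mulfV// mul1r sinpi. Qed.

Lemma ecos_fold1 k t : ecos (k%:~R * fold1 t) = ecos (k%:~R * t).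
Proof. by rewrite /fold1 mulrBr -intrM -mulrNz ecosDint. Qed.
Lemma esin_fold1 k t : esin (k%:~R * fold1 t) = esin (k%:~R * t).
Proof. by rewrite /fold1 mulrBr -intrM -mulrNz esinDint. Qed.

(** The function decreases on [0, 1/2] and is symmetric about 1/2. *)
Lemma ecos_lt1 (a b : R) (t : R) : 0 < a -> b < 1 -> a <= `|t| <= b ->
  ecos t <= Num.max (ecos a) (ecos b).
Proof.
move=> a0 b1 /andP[at_ tb].
have -> : ecos t = ecos `|t|.
  by case: (ger0P t) => // _; rewrite ecosN.
move: (`|t|) at_ tb => {}t at_ tb.
have pi0 := @pi_gt0 R.
rewrite le_max; have [t2|t2] := leP t (2^-1).
  rewrite /ecos; apply/orP; left.
  rewrite leNgt ltr_cos ?in_itv/=.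
  - by rewrite -leNgt; apply: ler_wpM2l => //; nra.
  - by apply/andP; split; nra.
  - by apply/andP; split; nra.
apply/orP; right.
have E s : ecos s = ecos (1 - s).
  by rewrite -(ecosN s) addrC -[X in _ + X]/(1%:~R) ecosDint.
rewrite (E t) (E b) /ecos leNgt ltr_cos ?in_itv/=.
- by rewrite -leNgt; apply: ler_wpM2l => //; nra.
- by apply/andP; split; nra.
- by apply/andP; split; nra.
Qed.

Lemma ecos_lt1_strict (t : R) : 0 < t < 1 -> ecos t < 1.
Proof.
move=> /andP[t0 t1].
rewrite lt_neqAle cos_le1 andbT.
apply/eqP => h.
have pi0 := @pi_gt0 R.
wlog t2 : t t0 t1 h / t <= 2^-1.
  move=> H; have [t2|t2] := leP t 2^-1; first exact: (H t).
  apply: (H (1 - t)); rewrite ?subr_gt0//; try lra.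
  by rewrite -[RHS]h -(ecosN t) addrC -[X in ecos (_ + X)]/(1%:~R) ecosDint.
have : (2 * pi * t) = 0.
  apply: cos_inj; rewrite ?in_itv/= ?cos0//; apply/andP; split; nra.
by move/eqP; rewrite gt_eqF// !mulr_gt0.
Qed.

End trigo.

(** * The Fejer kernel *)

Section fejer.
Context (R : realType).
Local Notation T := (measurableTypeR R).
Implicit Types (u w : T -> R) (k : int).

Lemma bm_ecos d (X : measurableType d) (f : X -> R) : measurable_fun setT f ->
  bounded_measurable (fun x => ecos (f x)).
Proof. by move=> mf; apply: bm_cos; exact: measurable_funM. Qed.
Lemma bm_esin d (X : measurableType d) (f : X -> R) : measurable_fun setT f ->
  bounded_measurable (fun x => esin (f x)).
Proof. by move=> mf; apply: bm_sin; exact: measurable_funM. Qed.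

Lemma bm_ecosl (c : R) : bounded_measurable (fun x : T => ecos (c * x)).
Proof. by apply: bm_ecos; exact: measurable_funM. Qed.
Lemma bm_esinl (c : R) : bounded_measurable (fun x : T => esin (c * x)).
Proof. by apply: bm_esin; exact: measurable_funM. Qed.

Definition ccoef u k : R := \int[circle R]_x (u x * ecos (k%:~R * x)).
Definition scoef u k : R := \int[circle R]_x (u x * esin (k%:~R * x)).

Lemma circle_cst (c : R) : \int[circle R]_x c = c.
Proof.
rewrite Rintegral_cst// [X in fine X](_ : _ = 1%E); first by rewrite mulr1.
exact: circle_setT.
Qed.

(** For k nonzero, translation by half a period of the integrand changes its sign
    but not the integral. *)
Lemma circle_ecos k : \int[circle R]_x ecos (k%:~R * x) = (k == 0)%:R.
Proof.
have [->|k0] := eqVneq k 0.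
  under eq_Rintegral do rewrite mul0r ecos0.
  by rewrite circle_cst.
pose z : R := (2 * k%:~R)^-1.
have := @bmint_fold1 R z _ (bm_ecosl k%:~R).
under eq_Rintegral.
  move=> x _; rewrite ecos_fold1 mulrDr ecosD.
  rewrite (_ : k%:~R * z = 2^-1); last first.
    by rewrite /z invfM mulrCA mulfV ?mulr1// intr_eq0.
  rewrite ecos_half esin_half mulr0 subr0 mulrN1 -mulN1r; over.
rewrite bmintZ; last exact: bm_ecosl.
by move: (Rintegral _ _ _) => I; rewrite mulr0n; lra.
Qed.

Lemma circle_esin k : \int[circle R]_x esin (k%:~R * x) = 0.
Proof.
have [->|k0] := eqVneq k 0.
  under eq_Rintegral do rewrite mul0r esin0.
  by rewrite circle_cst.
pose z : R := (2 * k%:~R)^-1.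
have := @bmint_fold1 R z _ (bm_esinl k%:~R).
under eq_Rintegral.
  move=> x _; rewrite esin_fold1 mulrDr esinD.
  rewrite (_ : k%:~R * z = 2^-1); last first.
    by rewrite /z invfM mulrCA mulfV ?mulr1// intr_eq0.
  rewrite ecos_half esin_half mulr0 addr0 mulrN1 -mulN1r; over.
rewrite bmintZ; last exact: bm_esinl.
by move: (Rintegral _ _ _) => I; lra.
Qed.

Lemma circle_ecosB k (y : R) :
  \int[circle R]_x ecos (k%:~R * (x - y)) = (k == 0)%:R.
Proof.
under eq_Rintegral do rewrite mulrBr ecosB mulrC [esin _ * _]mulrC.
rewrite bmintD; [|exact/bmZ/bm_ecosl|exact/bmZ/bm_esinl].
rewrite !bmintZ; [|exact: bm_esinl|exact: bm_ecosl].
rewrite circle_ecos circle_esin mulr0 addr0.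
by have [->|] := eqVneq k 0; rewrite ?mul0r ?ecos0 ?mulr1 ?mulr0.
Qed.

(** Written as a double sum, the Fejer kernel shows at once its positivity and the
    values (n - |k|) / n of its Fourier coefficients. *)
Definition fejer n (t : R) : R :=
  n%:R^-1 * \sum_(k < n) \sum_(l < n) ecos ((k%:Z - l%:Z)%:~R * t).

Lemma fejer_sqr n (t : R) : \sum_(k < n) \sum_(l < n) ecos ((k%:Z - l%:Z)%:~R * t) =
  (\sum_(k < n) ecos (k%:R * t)) ^+ 2 + (\sum_(k < n) esin (k%:R * t)) ^+ 2.
Proof.
rewrite !expr2 !big_distrl/= -big_split/=; apply: eq_bigr => k _.
rewrite !big_distrr/= -big_split/=; apply: eq_bigr => l _.
by rewrite intrB mulrBl ecosB.
Qed.

Lemma fejer_ge0 n t : 0 <= fejer n t.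
Proof.
rewrite /fejer fejer_sqr mulr_ge0 ?invr_ge0//.
by rewrite addr_ge0 ?sqr_ge0.
Qed.

(** Real and imaginary parts of (z - 1) (1 + z + ... + z^(n-1)) = z^n - 1 at the
    point z of the unit circle with argument 2 pi t. *)
Lemma dirichlet_closed n (t : R) :
  let X := \sum_(k < n) ecos (k%:R * t) in
  let Y := \sum_(k < n) esin (k%:R * t) in
  (ecos t - 1) * X - esin t * Y = ecos (n%:R * t) - 1 /\
  (ecos t - 1) * Y + esin t * X = esin (n%:R * t).
Proof.
elim: n => [|n [IH1 IH2]]; first by rewrite /= !big_ord0 mul0r ecos0 esin0; split; ring.
rewrite /= !big_ord_recr/= (_ : n.+1%:R * t = n%:R * t + t); last first.
  by rewrite -natr1 mulrDl mul1r.
rewrite ecosD esinD.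
move: IH1 IH2; set X := \sum_(i < n) ecos _; set Y := \sum_(i < n) esin _.
by move=> h1 h2; split; lra.
Qed.

(** With z as above, |z - 1|^2 |1 + ... + z^(n-1)|^2 = |z^n - 1|^2 <= 4, so away
    from the integers the kernel is of order 1/n. *)
Lemma fejer_le n (t eta : R) : (0 < n)%N -> 0 < eta -> ecos t <= 1 - eta ->
  fejer n t <= 2 / (n%:R * eta).
Proof.
move=> n0 eta0 ht.
have [h1 h2] := dirichlet_closed n t.
rewrite /fejer fejer_sqr.
move: (\sum_(k < n) ecos _) (\sum_(k < n) esin _) h1 h2 => X Y h1 h2.
have E : (2 - 2 * ecos t) * (X ^+ 2 + Y ^+ 2) = 2 - 2 * ecos (n%:R * t).
  have c1 := ecos2Desin2 t; have c2 := ecos2Desin2 (n%:R * t).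
  have sE : esin t ^+ 2 = 1 - ecos t ^+ 2 by rewrite -c1; ring.
  transitivity (((ecos t - 1) ^+ 2 + esin t ^+ 2) * (X ^+ 2 + Y ^+ 2)).
    by rewrite sE; ring.
  transitivity (((ecos t - 1) * X - esin t * Y) ^+ 2 +
                ((ecos t - 1) * Y + esin t * X) ^+ 2); first by ring.
  rewrite h1 h2.
  transitivity ((ecos (n%:R * t) ^+ 2 + esin (n%:R * t) ^+ 2) + 1 - 2 * ecos (n%:R * t)).
    by ring.
  by rewrite c2; ring.
have P0 : 0 <= X ^+ 2 + Y ^+ 2 by rewrite addr_ge0 ?sqr_ge0.
have : 2 - 2 * ecos (n%:R * t) <= 4.
  by have := ecos_max (n%:R * t); rewrite ler_norml => /andP[]; lra.
rewrite -E => h.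
have {}h : eta * (X ^+ 2 + Y ^+ 2) <= 2 by nra.
have n0' : n%:R != 0 :> R by rewrite pnatr_eq0 -lt0n.
rewrite ler_pdivlMr ?mulr_gt0 ?ltr0n//.
by rewrite mulrCA !mulrA mulfV// mul1r mulrC.
Qed.

Lemma bm_fejer n y : bounded_measurable (fun x : T => fejer n (x - y)).
Proof.
apply: bmZ; apply: bm_sum => k; apply: bm_sum => l.
apply: bm_ecos; apply: measurable_funM => //.
exact: measurable_funB.
Qed.

Lemma fejer_int n (y : R) : (0 < n)%N ->
  \int[circle R]_x fejer n (x - y) = 1.
Proof.
move=> n0.
have bm1 k : bounded_measurable (fun x : T => ecos (k%:~R * (x - y))).
  by apply: bm_ecos; apply: measurable_funM => //; exact: measurable_funB.
rewrite bmintZ; last by apply: bm_sum => k; apply: bm_sum => l; exact: bm1.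
rewrite bmint_sum; last by move=> k; apply: bm_sum => l; exact: bm1.
under eq_bigr.
  move=> k _; rewrite bmint_sum; last by move=> l; exact: bm1.
  under eq_bigr do rewrite circle_ecosB.
  rewrite (bigD1 k)//= subrr eqxx big1 ?addr0; first over.
  by move=> l lk; rewrite subr_eq0 eqz_nat -val_eqE/= eq_sym in lk *; rewrite (negbTE lk).
by rewrite sumr_const card_ord -mulr_natl mulr1 mulVf// pnatr_eq0 -lt0n.
Qed.

Definition cesaro n u (y : R) : R := \int[circle R]_x (u x * fejer n (x - y)).

(** The bilinear form of convolution with the Fejer kernel. This expression is
    symmetric and shows the coefficients; the one of [fejer_formE] shows the
    convergence to the scalar product. *)
Definition fejer_form n u w : R :=
  n%:R^-1 * \sum_(k < n) \sum_(l < n)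
    (ccoef u (k%:Z - l%:Z) * ccoef w (k%:Z - l%:Z) +
     scoef u (k%:Z - l%:Z) * scoef w (k%:Z - l%:Z)).

Lemma fejer_formC n u w : fejer_form n u w = fejer_form n w u.
Proof.
rewrite /fejer_form; congr (_ * _); apply: eq_bigr => k _; apply: eq_bigr => l _.
by congr (_ + _); rewrite mulrC.
Qed.

Lemma cesaroE n u (y : R) : bounded_measurable u -> cesaro n u y =
  n%:R^-1 * \sum_(k < n) \sum_(l < n)
    (ccoef u (k%:Z - l%:Z) * ecos ((k%:Z - l%:Z)%:~R * y) +
     scoef u (k%:Z - l%:Z) * esin ((k%:Z - l%:Z)%:~R * y)).
Proof.
move=> bu; rewrite /cesaro.
have bm1 k : bounded_measurable (fun x : T => u x * ecos (k%:~R * (x - y))).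
  by apply: bmM => //; apply: bm_ecos; apply: measurable_funM => //; exact: measurable_funB.
under eq_Rintegral.
  move=> x _; rewrite /fejer mulrCA big_distrr/=.
  under eq_bigr do rewrite big_distrr/=.
  over.
rewrite bmintZ; last by apply: bm_sum => k; apply: bm_sum => l; exact: bm1.
rewrite bmint_sum; last by move=> k; apply: bm_sum => l; exact: bm1.
congr (_ * _); apply: eq_bigr => k _.
rewrite bmint_sum; last by move=> l; exact: bm1.
apply: eq_bigr => l _; move: (k%:Z - l%:Z) => m.
under eq_Rintegral do rewrite mulrBr ecosB mulrDr !mulrA.
have bc := bmM bu (bm_ecosl m%:~R); have bs := bmM bu (bm_esinl m%:~R).
rewrite bmintD.
- by rewrite !bmintZr.
- exact: bmM bc (bm_cst _ _).
- exact: bmM bs (bm_cst _ _).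
Qed.

Lemma bm_cesaro n u : bounded_measurable u ->
  bounded_measurable (cesaro n u : T -> R).
Proof.
move=> bu.
have : bounded_measurable (fun y : T => n%:R^-1 * \sum_(k < n) \sum_(l < n)
    (ccoef u (k%:Z - l%:Z) * ecos ((k%:Z - l%:Z)%:~R * y) +
     scoef u (k%:Z - l%:Z) * esin ((k%:Z - l%:Z)%:~R * y))).
  apply: bmZ; apply: bm_sum => k; apply: bm_sum => l; apply: bmD; apply: bmZ.
    exact: bm_ecosl.
  exact: bm_esinl.
by congr bounded_measurable; apply/funext => y; rewrite cesaroE.
Qed.

Lemma fejer_formE n u w : bounded_measurable u -> bounded_measurable w ->
  fejer_form n u w = \int[circle R]_y (w y * cesaro n u y).
Proof.
move=> bu bw.
have bc m := bmM bw (bm_ecosl m%:~R); have bs m := bmM bw (bm_esinl m%:~R).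
have bm1 m : bounded_measurable (fun y : T => ccoef u m * (w y * ecos (m%:~R * y)) +
    scoef u m * (w y * esin (m%:~R * y))).
  by apply: bmD; exact: bmZ.
under eq_Rintegral.
  move=> y _; rewrite cesaroE// mulrCA big_distrr/=.
  under eq_bigr.
    move=> k _; rewrite big_distrr/=.
    under eq_bigr do rewrite mulrDr mulrCA [w _ * (scoef _ _ * _)]mulrCA.
    over.
  over.
rewrite bmintZ; last by apply: bm_sum => k; apply: bm_sum => l; exact: bm1.
rewrite bmint_sum; last by move=> k; apply: bm_sum => l; exact: bm1.
congr (_ * _); apply: eq_bigr => k _.
rewrite bmint_sum; last by move=> l; exact: bm1.
apply: eq_bigr => l _; move: (k%:Z - l%:Z) => m.
by rewrite bmintD ?bmintZ//; exact: bmZ.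
Qed.

Lemma cesaro_bound n u M (y : R) : (0 < n)%N -> bounded_measurable u ->
  (forall x, `|u x| <= M) -> `|cesaro n u y| <= M.
Proof.
move=> n0 bu uM; rewrite /cesaro.
have bf := bmM bu (bm_fejer n y).
apply: le_trans (bmint_norm (circle R) bf) _.
rewrite -[leRHS]mulr1 -(fejer_int y n0) -bmintZ; last exact: bm_fejer.
apply: le_bmint; [exact: bm_norm|exact/bmZ/bm_fejer|] => x.
by rewrite normrM (ger0_norm (fejer_ge0 _ _)) ler_wpM2r// fejer_ge0.
Qed.

End fejer.

(** * The Parseval inequality on the circle *)

Section parseval1.
Context (R : realType).
Local Notation T := (measurableTypeR R).
Implicit Types (u w : T -> R) (k : int).

Lemma measurable_off_unit_interval : measurable (~` @unit_interval R).
Proof. by apply: measurableC; exact: (@measurable_unit_interval R). Qed.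

Lemma circle_off_unit_interval : circle R (~` @unit_interval R) = 0%E.
Proof. by rewrite /circle /= /mfrestr /mrestr setICl measure0. Qed.

Lemma circle_interior : circle R (~` `]- 2^-1, 2^-1[%classic) = 0%E.
Proof.
rewrite /circle /= /mfrestr /mrestr.
rewrite (_ : _ `&` _ = [set - 2^-1 : T]); first by rewrite lebesgue_measure_set1.
apply/seteqP; split => x; rewrite /unit_interval /= !in_itv/=.
  move=> [h /andP[h1 h2]]; apply/eqP; rewrite eq_le h1 andbT leNgt.
  by apply/negP => h3; apply: h; rewrite h3 h2.
move=> ->; rewrite lexx ltxx; split => //=.
by rewrite (@lt_trans _ _ 0)// ?oppr_lt0 invr_gt0.
Qed.

Lemma bmint_circle (f : T -> R) : bounded_measurable f ->
  \int[circle R]_x f x = \int[lebesgue_measure]_(x in @unit_interval R) f x.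
Proof.
move=> bf; have mJ := measurable_off_unit_interval.
rewrite (bmint_off_null mJ circle_off_unit_interval)// setCK.
rewrite /Rintegral; congr fine; apply: eq_measure_integral => A mA AJ.
by rewrite /circle /= /mfrestr /mrestr setIidl.
Qed.

(** The kernel has integral one. Near y the continuity of u is used, elsewhere
    the kernel is of order 1/n; as y is interior, differences x - y stay away from
    all integers but 0. *)
Lemma cesaro_cvg u (M y : R) : bounded_measurable u -> (forall x, `|u x| <= M) ->
  {for y, continuous (u : R -> R)} -> - 2^-1 < y < 2^-1 ->
  cesaro n u y @[n --> \oo] --> u y.
Proof.
move=> bu uM cu /andP[y1 y2]; apply/cvgrPdist_le => e e0.
have M0 : 0 <= M by apply: le_trans (uM 0).
have [d0 d00 hd0] : exists2 d, 0 < d & forall x, `|x - y| < d -> `|u x - u y| <= e / 2.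
  have /cvgrPdist_le/(_ (e / 2)) := cu; rewrite divr_gt0// => /(_ isT).
  move=> /nbhs_ballP[d /= dp hd]; exists d => // x xy.
  by rewrite distrC; apply: hd; rewrite /ball/= distrC.
pose d := Num.min d0 2^-1.
have dp : 0 < d by rewrite lt_min d00 invr_gt0/=.
have hd x : `|x - y| < d -> `|u x - u y| <= e / 2.
  by move=> h; apply: hd0; rewrite (lt_le_trans h)// ge_min lexx.
(* An upper bound below 1 for |x - y| with x in the interval. *)
pose b := 2^-1 + `|y|.
have b1 : b < 1.
  by rewrite /b -ltrBrDl [X in _ < X](_ : _ = 2^-1) ?ltr_norml ?y1//; lra.
have b0 : 0 < b by rewrite /b ltr_pwDl// invr_gt0.
have d1 : d < 1.
  by rewrite gt_min; apply/orP; right; rewrite invf_lt1// ltr1n.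
pose eta := 1 - Num.max (ecos d) (ecos b).
have eta0 : 0 < eta.
  by rewrite /eta subr_gt0 gt_max !ecos_lt1_strict ?dp ?d1 ?b0 ?b1.
near=> n.
have n0 : (0 < n)%N by near: n; exact: nbhs_infty_gt.
have -> : u y - cesaro n u y = - \int[circle R]_x ((u x - u y) * fejer n (x - y)).
  have bf := bm_fejer n y.
  under eq_Rintegral do rewrite mulrBl.
  rewrite bmintB; [|exact: bmM|exact: bmZ].
  by rewrite bmintZ// fejer_int// mulr1 opprB.
rewrite normrN.
have bf := bm_fejer n y.
have bdf : bounded_measurable (fun x => (u x - u y) * fejer n (x - y)).
  by apply: bmM => //; apply: bmB => //; exact: bm_cst.
apply: le_trans (bmint_norm _ bdf) _.
pose c := 2 * M * (2 / (n%:R * eta)).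
have c0 : 0 <= c.
  by rewrite /c !mulr_ge0// invr_ge0 mulr_ge0// ltW.
apply: (@le_trans _ _ (\int[circle R]_x (e / 2 * fejer n (x - y) + c))).
  apply: (le_bmint_off_null measurable_off_unit_interval circle_off_unit_interval).
  - exact: bm_norm.
  - by apply: bmD; [exact: bmZ|exact: bm_cst].
  move=> x /contrapT; rewrite /unit_interval /= in_itv/= => /andP[x1 x2].
  rewrite normrM (ger0_norm (fejer_ge0 _ _)).
  have [xy|xy] := ltP `|x - y| d.
    rewrite (@le_trans _ _ (e / 2 * fejer n (x - y))) ?lerDl//.
    by rewrite ler_wpM2r ?fejer_ge0 ?hd.
  rewrite (@le_trans _ _ c)//; last by rewrite lerDr mulr_ge0 ?fejer_ge0// divr_ge0// ltW.
  apply: ler_pM => //; first exact: fejer_ge0.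
    apply: le_trans (ler_normB _ _) _.
    by rewrite mulr2n mulrDl mul1r lerD.
  apply: fejer_le => //; rewrite /eta subKr.
  apply: ecos_lt1 => //; rewrite xy /b/=.
  apply: le_trans (ler_normB _ _) _; rewrite lerD2r.
  by rewrite ler_norml x1 ltW.
rewrite bmintD; [|exact: bmZ|exact: bm_cst].
rewrite bmintZ// fejer_int// mulr1 circle_cst.
suff : c <= e / 2 by lra.
rewrite /c mulrA ler_pdivrMr; last by rewrite mulr_gt0// ltr0n.
rewrite -ler_pdivrMl; last by rewrite divr_gt0.
rewrite -ler_pdivrMr//.
near: n; exact: nbhs_infty_ger.
Unshelve. all: by end_near.
Qed.

(** For each l the frequencies k - l are pairwise distinct, so each inner sum is
    at most the whole series, and the form is the average of these sums over l. *)
Lemma fejer_form_le n u : (0 < n)%N ->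
  ((fejer_form n u u)%:E <=
   \esum_(m in [set: int]) (ccoef u m ^+ 2 + scoef u m ^+ 2)%:E)%E.
Proof.
move=> n0; set E := \esum_(_ in _) _.
pose a (m : int) := ccoef u m ^+ 2 + scoef u m ^+ 2.
have a0 m : (0 <= (a m)%:E)%E by rewrite lee_fin addr_ge0 ?sqr_ge0.
have h (l : 'I_n) : ((\sum_(k < n) a (k%:Z - l%:Z))%:E <= E)%E.
  rewrite -sumEFin -(esum_finType (fun k : 'I_n => a0 _)).
  apply: (@esum_inj_le _ _ _ setT (fun k : 'I_n => k%:Z - l%:Z) (EFin \o a)) => //.
  by move=> i j _ _ /addIr [] /val_inj.
have E0 : (0 <= E)%E by apply: esum_ge0 => m _; exact: a0.
have [Efin|] := boolP (E \is a fin_num); last first.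
  by rewrite ge0_fin_numE// -leNgt leye_eq => /eqP ->; rewrite leey.
move: h E0; rewrite -(fineK Efin) => h E0.
rewrite lee_fin /fejer_form mulrC ler_pdivrMr ?ltr0n// exchange_big/=.
rewrite (@le_trans _ _ (\sum_(l < n) fine E))//.
  apply: ler_sum => l _; rewrite -lee_fin; apply: le_trans (h l).
  by rewrite lee_fin; apply: ler_sum => k _; rewrite /a !expr2.
by rewrite sumr_const card_ord mulr_natr.
Qed.

(** Clipping a continuous approximation to [-M, M] brings it closer to u. *)
Lemma continuous_approx u (M e : R) : bounded_measurable u -> (forall x, `|u x| <= M) ->
  0 < e -> exists c : T -> R, [/\ bounded_measurable c, continuous (c : R -> R),
    forall x, `|c x| <= M & \int[circle R]_x `|u x - c x| <= e].
Proof.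
move=> bu uM e0.
have mJ := @measurable_unit_interval R.
have lJ : (lebesgue_measure (@unit_interval R) < +oo)%E.
  by rewrite lebesgue_unit_interval ltry.
have M0 : 0 <= M by apply: le_trans (uM 0).
have iu : lebesgue_measure.-integrable (@unit_interval R) (EFin \o u).
  apply: measurable_bounded_integrable => //.
  - by apply: measurable_funTS; case: bu.
  - exists M; split; [exact: num_real|move=> z Mz x _].
    exact: le_trans (uM x) (ltW Mz).
have [g [cg ig /fine_cvg hg]] :=
  @approximation_continuous_integrable R (@unit_interval R) u mJ lJ iu.
have [n hn] : exists n,
    \int[lebesgue_measure]_(x in @unit_interval R) `|u x - g n x| <= e.
  move/cvgrPdist_le : hg => /(_ e e0) [n _ /(_ n (leqnn n)) h]; exists n.
  apply: le_trans h; rewrite sub0r normrN; exact: ler_norm.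
pose c (x : T) : R := Num.max (- M) (Num.min M (g n x)).
have cM x : `|c x| <= M.
  rewrite /c ler_norml le_max lexx/= ge_max ge_min lexx/= andbT.
  by rewrite (@le_trans _ _ 0)// oppr_le0.
have cc : continuous (c : R -> R).
  move=> x; apply: (@continuous_max R R (cst (- M)) _ x); first exact: cst_continuous.
  apply: (@continuous_min R R (cst M) _ x); first exact: cst_continuous.
  exact: cg.
have bc : bounded_measurable c.
  by split; [exact: continuous_measurable_fun|exists M].
exists c; split => //.
rewrite bmint_circle; last by apply: bm_norm; exact: bmB.
apply: le_trans hn.
apply: le_Rintegral => //.
- apply: measurable_bounded_integrable => //.
  + by apply: measurable_funTS; have [] := bm_norm (bmB bu bc).
  + have [_ [K hK]] := bm_norm (bmB bu bc).
    exists K; split; [exact: num_real|move=> z Kz x _].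
    exact: le_trans (hK x) (ltW Kz).
- have := integrable_norm (integrableB mJ iu (ig n)).
  by apply: eq_integrable.
move=> x _; have := uM x; rewrite ler_norml => /andP[u1 u2].
have [g1|g1] := ltP (g n x) (- M).
  have -> : c x = - M by rewrite /c min_r ?max_l//; lra.
  by rewrite !ger0_norm; lra.
have [g2|g2] := ltP M (g n x).
  have -> : c x = M by rewrite /c min_l ?max_r//; lra.
  by rewrite !ler0_norm; lra.
by have -> : c x = g n x by rewrite /c min_r ?max_r//; lra.
Qed.

(** Write u = c + (u - c) with c continuous and close to u in the mean. The Fejer
    form at u differs from the integral of u^2 by terms bounded by M times the L^1
    norms of u - c and of c minus its Cesaro mean. *)
Theorem parseval_circle_real u : bounded_measurable u ->
  ((\int[circle R]_x u x ^+ 2)%:E <=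
   \esum_(m in [set: int]) (ccoef u m ^+ 2 + scoef u m ^+ 2)%:E)%E.
Proof.
move=> bu; have [_ [M uM]] := bu.
have M0 : 0 <= M by apply: le_trans (uM 0).
set E := \esum_(_ in _) _.
have E0 : (0 <= E)%E by apply: esum_ge0 => m _; rewrite lee_fin addr_ge0 ?sqr_ge0.
have [Efin|] := boolP (E \is a fin_num); last first.
  by rewrite ge0_fin_numE// -leNgt leye_eq => /eqP ->; rewrite leey.
rewrite -(fineK Efin) lee_fin; apply/ler_addgt0Pr => e e0.
pose e' := e / (4 * (M + 1)).
have e'0 : 0 < e' by rewrite divr_gt0// mulr_gt0// ltr_wpDl.
have [c [bc cc cM uc]] := continuous_approx bu uM e'0.
have bw := bmB bu bc; have bnw := bm_norm bw.
have bD n : bounded_measurable (fun y : T => `|cesaro n c y - c y|).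
  by apply: bm_norm; apply: bmB => //; exact: bm_cesaro.
have : \int[circle R]_y `|cesaro n.+1 c y - c y| @[n --> \oo] --> 0.
  have mN : measurable (~` `]- 2^-1, 2^-1[%classic : set T).
    by apply: measurableC; exact: measurable_itv.
  apply: (bmint_cvg0 mN circle_interior (M := M + M)).
  - by move=> n; exact: bD.
  - move=> n x; rewrite normr_id; apply: le_trans (ler_normB _ _) _.
    by rewrite lerD// cesaro_bound.
  - move=> x /contrapT; rewrite /= in_itv/= => hx.
    have := cesaro_cvg bc cM (cc x) hx.
    rewrite -(cvg_shiftS (fun n => cesaro n c x)) => /cvgB/(_ (cvg_cst (c x))).
    by rewrite subrr => /cvg_norm; rewrite normr0.
move/cvgrPdist_le => /(_ e' e'0) [n _ /(_ n (leqnn n))] /=.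
rewrite sub0r normrN => /(le_trans (ler_norm _)) hD.
have := @fejer_form_le n.+1 u (ltn0Sn n); rewrite -/E -(fineK Efin) lee_fin => hE.
have bT := bm_cesaro n.+1 bc.
have bTu := bm_cesaro n.+1 bu.
have bTw := bm_cesaro n.+1 bw.
have ebound f g : bounded_measurable f -> bounded_measurable g ->
    (forall x, `|f x| <= M) -> \int[circle R]_y (g y * f y) <= M * \int[circle R]_y `|g y|.
  move=> bf bg fM; rewrite -bmintZ; last exact: bm_norm.
  apply: le_bmint; [exact: bmM|apply: bmZ; exact: bm_norm|] => x.
  apply: le_trans (ler_norm _) _; rewrite normrM mulrC.
  by rewrite ler_wpM2r.
(* Polarisation of the Fejer form at u = c + (u - c). The first remainder is
   the error of replacing u by c in the integral, the other two are controlled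
   by the approximation of c by its means and by the L^1 distance of u and c. *)
have key : \int[circle R]_x u x ^+ 2 =
  fejer_form n.+1 u u + \int[circle R]_y ((u y - c y) * u y)
  + \int[circle R]_y ((c y - cesaro n.+1 c y) * u y)
  + \int[circle R]_y ((u y - c y) * (- cesaro n.+1 u y)).
  have -> : \int[circle R]_y ((u y - c y) * - cesaro n.+1 u y) =
     - fejer_form n.+1 (fun y => u y - c y) u.
    rewrite fejer_formC fejer_formE// -[RHS]mulN1r -bmintZ; last exact: bmM.
    by apply: eq_Rintegral => y _; rewrite mulrN mulN1r.
  rewrite !fejer_formE// -!addrA -[X in _ + (_ + (_ + X))]mulN1r -bmintZ; last exact: bmM.
  rewrite -bmintD; [|by apply: bmM => //; exact: bmB|by apply: bmZ; exact: bmM].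
  rewrite -bmintD; [|exact: bmM|]; last first.
    by apply: bmD; [apply: bmM => //; exact: bmB|apply: bmZ; exact: bmM].
  rewrite -bmintD; [|exact: bmM|]; last first.
    apply: bmD; first exact: bmM.
    by apply: bmD; [apply: bmM => //; exact: bmB|apply: bmZ; exact: bmM].
  apply: eq_Rintegral => y _.
  have -> : cesaro n.+1 (fun y => u y - c y) y = cesaro n.+1 u y - cesaro n.+1 c y.
    rewrite /cesaro; under eq_Rintegral do rewrite mulrBl.
    by rewrite bmintB//; apply: bmM => //; exact: bm_fejer.
  ring.
rewrite key -!addrA lerD//.
have h1 := ebound _ _ bu bw uM.
have h2 := ebound _ _ bu (bmB bc bT) uM.
have h3 := ebound _ _ (bmN bTu) bw (fun x => _).
have {}h3 : \int[circle R]_y ((u y - c y) * (- cesaro n.+1 u y)) <=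
    M * \int[circle R]_y `|u y - c y|.
  by apply: h3 => x; rewrite normrN cesaro_bound.
have E2 : \int[circle R]_y `|c y - cesaro n.+1 c y| <= e'.
  by under eq_Rintegral do rewrite distrC.
have h4 : M * \int[circle R]_y `|u y - c y| <= M * e' by rewrite ler_wpM2l.
have h5 : M * \int[circle R]_y `|c y - cesaro n.+1 c y| <= M * e' by rewrite ler_wpM2l.
apply: le_trans (lerD h1 (lerD h2 h3)) _.
apply: le_trans (lerD h4 (lerD h5 h4)) _.
suff : M * e' * 4 <= e by have := mulr_ge0 M0 (ltW e'0); lra.
rewrite /e' -mulrA mulrAC mulrA ler_pdivrMr; last by rewrite mulr_gt0// ltr_wpDl.
nra.
Qed.

End parseval1.

Section parseval_circle.
Context (R : realType).
Local Notation T := (measurableTypeR R).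
Implicit Types (u v : T -> R).

Lemma ccoefN u k : ccoef u (- k) = ccoef u k.
Proof. by apply: eq_Rintegral => x _; rewrite mulrNz mulNr ecosN. Qed.

Lemma scoefN u k : bounded_measurable u -> scoef u (- k) = - scoef u k.
Proof.
move=> bu; rewrite -[RHS]mulN1r -bmintZ; last exact: bmM bu (bm_esinl _).
by apply: eq_Rintegral => x _; rewrite mulrNz mulNr esinN mulrN mulN1r.
Qed.

(** Here u + i v is a complex function. The squared moduli of its coefficients
    differ from the sum of those of u and v by a cross term that is odd in the
    frequency, hence cancels in the sum. *)
Lemma parseval_circle u v : bounded_measurable u -> bounded_measurable v ->
  ((\int[circle R]_x (u x ^+ 2 + v x ^+ 2))%:E <=
   \esum_(k in [set: int]) ((ccoef u k + scoef v k) ^+ 2 +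
     (ccoef v k - scoef u k) ^+ 2)%:E)%E.
Proof.
move=> bu bv.
pose P k : \bar R := ((ccoef u k + scoef v k) ^+ 2 + (ccoef v k - scoef u k) ^+ 2)%:E.
pose A w k : \bar R := (ccoef w k ^+ 2 + scoef w k ^+ 2)%:E.
have P0 k : (0 <= P k)%E by rewrite lee_fin addr_ge0 ?sqr_ge0.
have A0 w k : (0 <= A w k)%E by rewrite lee_fin addr_ge0 ?sqr_ge0.
rewrite bmintD; [|exact: bm_sqr|exact: bm_sqr].
rewrite EFinD.
apply: le_trans (leeD (parseval_circle_real bu) (parseval_circle_real bv)) _.
rewrite -esumD; [|by move=> k _; exact: A0|by move=> k _; exact: A0].
set X := esum _ _; set Y := esum _ _.
have PN : \esum_(k in [set: int]) P (- k) = Y.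
  have bij : set_bij [set: int] [set: int] (fun k : int => - k).
    by rewrite setTT_bijective; exists (fun k : int => - k); exact: opprK.
  by rewrite -(reindex_esum _ _ _ P bij).
(* The terms at k and -k of the sums X and Y have the same total. *)
have : (X + X = Y + Y)%E.
  rewrite -{2}PN -!esumD//; try by move=> k _;
    first [exact: P0|exact: A0|apply: adde_ge0; exact: A0].
  apply: eq_esum => k _.
  rewrite /P /A ccoefN !scoefN// ccoefN -!EFinD; congr EFin; ring.
have X0 : (0 <= X)%E by apply: esum_ge0 => k _; apply: adde_ge0; exact: A0.
have Y0 : (0 <= Y)%E by apply: esum_ge0 => k _; exact: P0.
move: X0 Y0; rewrite {PN}; move: X Y => [x| |] [y| |]//= _ _.
  by rewrite -!EFinD => -[h]; rewrite lee_fin; lra.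
Qed.

End parseval_circle.

(** * The Parseval inequality on the torus *)

Section parseval_torus.
Context (R : realType).
Local Notation T := (measurableTypeR R).

Definition idot d (m : d.-tuple int) (x : d.-tuple R) : R :=
  \sum_(i < d) (tnth m i)%:~R * tnth x i.

Definition icons d (p : int * d.-tuple int) : d.+1.-tuple int := [tuple of p.1 :: p.2].

Lemma icons_inj d : injective (@icons d).
Proof.
by move=> [k m] [l n] /(congr1 val) /= [-> /val_inj ->].
Qed.

Lemma idot_cons d k (m : d.-tuple int) t (y : d.-tuple R) :
  idot (icons (k, m)) (cons_pair (t, y)) = k%:~R * t + idot m y.
Proof.
rewrite /idot big_ord_recl; congr (_ + _).
by apply: eq_bigr => i _; rewrite !tnthS.
Qed.

Lemma measurable_idot d (m : d.-tuple int) : measurable_fun setT (idot m : d.-tuple T -> R).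
Proof.
apply: measurable_sum => i; apply: measurable_funM => //.
exact: measurable_tnth.
Qed.

Definition tcos d (u : d.-tuple T -> R) (m : d.-tuple int) : R :=
  \int[torus R d]_x (u x * ecos (idot m x)).
Definition tsin d (u : d.-tuple T -> R) (m : d.-tuple int) : R :=
  \int[torus R d]_x (u x * esin (idot m x)).

Lemma bm_tcos d u (m : d.-tuple int) : bounded_measurable u ->
  bounded_measurable (fun x : d.-tuple T => u x * ecos (idot m x)).
Proof. by move=> bu; apply: bmM => //; apply: bm_ecos; exact: measurable_idot. Qed.

Lemma bm_tsin d u (m : d.-tuple int) : bounded_measurable u ->
  bounded_measurable (fun x : d.-tuple T => u x * esin (idot m x)).
Proof. by move=> bu; apply: bmM => //; apply: bm_esin; exact: measurable_idot. Qed.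

Lemma tcosD d (u v : d.-tuple T -> R) m : bounded_measurable u -> bounded_measurable v ->
  tcos (fun x => u x + v x) m = tcos u m + tcos v m.
Proof.
move=> bu bv; rewrite /tcos; under eq_Rintegral do rewrite mulrDl.
by rewrite bmintD//; exact: bm_tcos.
Qed.

Lemma tsinD d (u v : d.-tuple T -> R) m : bounded_measurable u -> bounded_measurable v ->
  tsin (fun x => u x + v x) m = tsin u m + tsin v m.
Proof.
move=> bu bv; rewrite /tsin; under eq_Rintegral do rewrite mulrDl.
by rewrite bmintD//; exact: bm_tsin.
Qed.

Lemma tcosB d (u v : d.-tuple T -> R) m : bounded_measurable u -> bounded_measurable v ->
  tcos (fun x => u x - v x) m = tcos u m - tcos v m.
Proof.
move=> bu bv; rewrite /tcos; under eq_Rintegral do rewrite mulrBl.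
by rewrite bmintB//; exact: bm_tcos.
Qed.

Lemma tsinB d (u v : d.-tuple T -> R) m : bounded_measurable u -> bounded_measurable v ->
  tsin (fun x => u x - v x) m = tsin u m - tsin v m.
Proof.
move=> bu bv; rewrite /tsin; under eq_Rintegral do rewrite mulrBl.
by rewrite bmintB//; exact: bm_tsin.
Qed.

Definition slice d (u : d.+1.-tuple T -> R) (y : d.-tuple T) (t : T) : R :=
  u (cons_pair (t, y)).

Lemma bm_slice d (u : d.+1.-tuple T -> R) y : bounded_measurable u ->
  bounded_measurable (slice u y).
Proof. by move=> bu; exact: (bm_pair1 y (bm_cons bu)). Qed.

Lemma bm_ccoef_slice d (u : d.+1.-tuple T -> R) k : bounded_measurable u ->
  bounded_measurable (fun y : d.-tuple T => ccoef (slice u y) k).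
Proof.
move=> bu; rewrite /ccoef.
apply: (@bm_partial1 _ _ _ _ _ (circle R) (torus R d)
   (fun p : T * d.-tuple T => (u \o @cons_pair R d) p * ecos (k%:~R * p.1))).
apply: bmM; first exact: bm_cons.
by apply: bm_ecos; apply: measurable_funM => //; exact: measurable_fst.
Qed.

Lemma bm_scoef_slice d (u : d.+1.-tuple T -> R) k : bounded_measurable u ->
  bounded_measurable (fun y : d.-tuple T => scoef (slice u y) k).
Proof.
move=> bu; rewrite /scoef.
apply: (@bm_partial1 _ _ _ _ _ (circle R) (torus R d)
   (fun p : T * d.-tuple T => (u \o @cons_pair R d) p * esin (k%:~R * p.1))).
apply: bmM; first exact: bm_cons.
by apply: bm_esin; apply: measurable_funM => //; exact: measurable_fst.
Qed.

(** Fubini and the addition formula: coefficients in dimension d + 1 are those of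
    the partial coefficients in the first variable. *)
Lemma tcos_cons d (u : d.+1.-tuple T -> R) k m : bounded_measurable u ->
  tcos u (icons (k, m)) =
  tcos (fun y => ccoef (slice u y) k) m - tsin (fun y => scoef (slice u y) k) m.
Proof.
move=> bu; rewrite /tcos bmint_torus_cons; last exact: bm_tcos.
rewrite /tsin -bmintB; [|exact/bm_tcos/bm_ccoef_slice|exact/bm_tsin/bm_scoef_slice].
apply: eq_Rintegral => y _.
under eq_Rintegral do rewrite idot_cons ecosD mulrBr !mulrA.
have bs := bm_slice y bu.
rewrite bmintB.
- by rewrite !bmintZr//; apply: bmM bs _; [exact: bm_esinl|exact: bm_ecosl].
- by apply: bmM (bm_cst _ _); apply: bmM bs (bm_ecosl _).
- by apply: bmM (bm_cst _ _); apply: bmM bs (bm_esinl _).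
Qed.

Lemma tsin_cons d (u : d.+1.-tuple T -> R) k m : bounded_measurable u ->
  tsin u (icons (k, m)) =
  tcos (fun y => scoef (slice u y) k) m + tsin (fun y => ccoef (slice u y) k) m.
Proof.
move=> bu; rewrite /tsin bmint_torus_cons; last exact: bm_tsin.
rewrite /tcos -bmintD; [|exact/bm_tcos/bm_scoef_slice|exact/bm_tsin/bm_ccoef_slice].
apply: eq_Rintegral => y _.
under eq_Rintegral do rewrite idot_cons esinD mulrDr !mulrA.
have bs := bm_slice y bu.
rewrite bmintD.
- by rewrite !bmintZr//; apply: bmM bs _; [exact: bm_ecosl|exact: bm_esinl].
- by apply: bmM (bm_cst _ _); apply: bmM bs (bm_esinl _).
- by apply: bmM (bm_cst _ _); apply: bmM bs (bm_ecosl _).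
Qed.

(** Induction on the dimension, with Parseval on the circle in the first variable
    and the induction hypothesis for the partial coefficients. These are complex
    even for a real function, hence the pair of real functions u and v. *)
Theorem parseval_torus d (u v : d.-tuple T -> R) :
  bounded_measurable u -> bounded_measurable v ->
  ((\int[torus R d]_x (u x ^+ 2 + v x ^+ 2))%:E <=
   \esum_(m in [set: d.-tuple int]) ((tcos u m + tsin v m) ^+ 2 +
     (tcos v m - tsin u m) ^+ 2)%:E)%E.
Proof.
elim: d => [|d IH] in u v *.
  move=> bu bv.
  pose a (m : 0.-tuple int) : \bar R :=
    ((tcos u m + tsin v m) ^+ 2 + (tcos v m - tsin u m) ^+ 2)%:E.
  apply: (@le_trans _ _ (\esum_(m in [set [tuple] : 0.-tuple int]) a m)%E); last first.
    by apply: esum_subset => // m; rewrite lee_fin addr_ge0 ?sqr_ge0.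
  rewrite esum_set1; last by rewrite lee_fin addr_ge0 ?sqr_ge0.
  rewrite /a lee_fin /tcos /tsin !bmint_torus0//; first last.
  - by apply: bmD; exact: bm_sqr.
  - exact: bm_tcos.
  - exact: bm_tsin.
  - exact: bm_tcos.
  - exact: bm_tsin.
  by rewrite /idot big_ord0 ecos0 esin0 !mulr0 !mulr1 addr0 subr0.
move=> bu bv.
pose U k y := ccoef (slice u y) k + scoef (slice v y) k.
pose V k y := ccoef (slice v y) k - scoef (slice u y) k.
have bU k : bounded_measurable (U k).
  by apply: bmD; [exact: bm_ccoef_slice|exact: bm_scoef_slice].
have bV k : bounded_measurable (V k).
  by apply: bmB; [exact: bm_ccoef_slice|exact: bm_scoef_slice].
have bUV k : bounded_measurable (fun y => U k y ^+ 2 + V k y ^+ 2).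
  by apply: bmD; exact: bm_sqr.
have b2 : bounded_measurable (fun x => u x ^+ 2 + v x ^+ 2).
  by apply: bmD; exact: bm_sqr.
rewrite bmint_torus_cons// EFin_bmint; last first.
  exact: (@bm_partial1 _ _ _ _ _ (circle R) (torus R d) _ (bm_cons b2)).
apply: (@le_trans _ _ (\int[torus R d]_y \esum_(k in [set: int])
    (U k y ^+ 2 + V k y ^+ 2)%:E)%E).
  apply: ge0_le_integral => //.
  - move=> y _; rewrite lee_fin; apply: Rintegral_ge0 => t _.
    by rewrite addr_ge0 ?sqr_ge0.
  - apply/measurable_EFinP.
    by case: (@bm_partial1 _ _ _ _ _ (circle R) (torus R d) _ (bm_cons b2)).
  - apply: measurable_esum_int => [k y|k].
      by rewrite lee_fin addr_ge0 ?sqr_ge0.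
    by apply/measurable_EFinP; case: (bUV k).
  - move=> y _; exact: (parseval_circle (bm_slice y bu) (bm_slice y bv)).
rewrite integral_esum_int; last 2 first.
- by move=> k y; rewrite lee_fin addr_ge0 ?sqr_ge0.
- by move=> k; apply/measurable_EFinP; case: (bUV k).
pose b (m : d.+1.-tuple int) : \bar R :=
  ((tcos u m + tsin v m) ^+ 2 + (tcos v m - tsin u m) ^+ 2)%:E.
have b0 m : (0 <= b m)%E by rewrite lee_fin addr_ge0 ?sqr_ge0.
apply: (@le_trans _ _ (\esum_(k in [set: int]) \esum_(m in [set: d.-tuple int])
   b (icons (k, m)))%E).
  apply: le_esum => k _; rewrite -EFin_bmint//.
  apply: le_trans (IH _ _ (bU k) (bV k)) _.
  have b1 := bm_ccoef_slice k bu; have b3 := bm_scoef_slice k bu.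
  have b4 := bm_ccoef_slice k bv; have b5 := bm_scoef_slice k bv.
  apply: le_esum => m _.
  have E1 : tcos (U k) m + tsin (V k) m = tcos u (icons (k, m)) + tsin v (icons (k, m)).
    rewrite tcos_cons// tsin_cons// (tcosD m b1 b5) (tsinB m b4 b3).
    by rewrite [X in _ + X]addrC addrACA.
  have E2 : tcos (V k) m - tsin (U k) m = tcos v (icons (k, m)) - tsin u (icons (k, m)).
    rewrite tcos_cons// tsin_cons// (tcosB m b4 b3) (tsinD m b1 b5) !opprD.
    by rewrite [X in _ + X]addrC addrACA.
  by rewrite E1 E2.
rewrite esum_esum; last by move=> k m _ _; exact: b0.
apply: (@le_trans _ _ (\esum_(p in [set: int * d.-tuple int]) b (icons p))%E).
  rewrite (_ : _ `*`` _ = setT); last by apply/seteqP; split.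
  by apply: le_esum => -[].
by apply: (@esum_inj_le _ _ _ setT (@icons d) b) => // x y _ _; exact: icons_inj.
Qed.

End parseval_torus.

(** * Completion of a measure and Borel models of a set *)

Section completion.
Context d (T : measurableType d) (R : realType) (mu : {measure set T -> \bar R}).
Local Notation caraT := (caratheodory_type (mu^*)%mu).
Local Notation nu := (@completed_measure_extension _ _ _ mu).
Local Open Scope ereal_scope.

(** Intersection of countable measurable covers whose total measures exceed the
    outer measure of A by less and less. *)
Lemma borel_hull (A : set T) : (mu^*)%mu A < +oo ->
  exists H, [/\ measurable H, A `<=` H & mu H <= (mu^*)%mu A].
Proof.
move=> Aoo.
have Afin : (mu^*)%mu A \is a fin_num by rewrite ge0_fin_numE//; exact: mu_ext_ge0.
have inv0 n : (0 < n.+1%:R^-1 :> R)%R by rewrite invr_gt0.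
have cover n : exists F, [/\ measurable F, A `<=` F &
    mu F <= (mu^*)%mu A + (n.+1%:R^-1)%:E].
  have /(lb_ereal_inf_adherent (inv0 n)) := Afin.
  move=> [_ [B [mB AB] <-]] h.
  exists (\bigcup_k B k); split => //; first exact: bigcupT_measurable.
  apply: le_trans (ltW h); apply: measure_sigma_subadditive => //.
  exact: bigcupT_measurable.
pose F n := projT1 (cid (cover n)).
have FP n : [/\ measurable (F n), A `<=` F n & mu (F n) <= (mu^*)%mu A + (n.+1%:R^-1)%:E].
  by rewrite /F; case: cid.
have mF : measurable (\bigcap_n F n).
  by apply: bigcapT_measurable => n; case: (FP n).
exists (\bigcap_n F n); split => //.
  by move=> x Ax n _; case: (FP n) => _ + _; apply.
apply/lee_addgt0Pr => /= _/posnumP[e]; near \oo => n.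
apply: (@le_trans _ _ (mu (F n))).
  by apply: le_measure; rewrite ?inE//; [case: (FP n)|exact: bigcap_inf].
case: (FP n) => _ _ h; apply: le_trans h _; rewrite leeD2l// lee_fin ltW//.
by near: n; apply: near_infty_natSinv_lt.
Unshelve. all: by end_near. Qed.

(** E is a hull of A; by measurability of A the difference has outer measure zero,
    and Z is a hull of it. *)
Lemma borel_approx (A : set T) : (mu^*)%mu.-cara.-measurable A ->
  (mu^*)%mu A < +oo -> exists E Z, [/\ measurable E, measurable Z, mu Z = 0,
    A `<=` E & E `\` A `<=` Z].
Proof.
move=> mA Aoo; have [E [mE AE muE]] := borel_hull Aoo.
have mE' : (mu^*)%mu.-cara.-measurable E by exact: caratheodory_measurable_mu_ext.
have EA0 : (mu^*)%mu (E `\` A) = 0.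
  rewrite -[LHS]/(nu (E `\` A)).
  rewrite measureD//; last first.
    by rewrite /= /completed_measure_extension measurable_mu_extE// (le_lt_trans muE).
  rewrite setIidr// /= /completed_measure_extension (measurable_mu_extE _ mE).
  have -> : mu E = (mu^*)%mu A.
    apply/eqP; rewrite eq_le muE/= -(measurable_mu_extE mu mE).
    exact: le_mu_ext.
  by rewrite subee// ge0_fin_numE//; exact: mu_ext_ge0.
have [|Z [mZ EZ muZ]] := @borel_hull (E `\` A); first by rewrite EA0 ltry.
exists E, Z; split => //; apply/eqP.
by rewrite -measure_le0 -EA0.
Qed.

Definition cara_id : caraT -> T := id.

(** Through this map the completion is the original measure pushed forward, which
    transfers integrals of Borel functions from one to the other. *)
Lemma measurable_cara_id : measurable_fun setT cara_id.
Proof. by move=> _ Y mY; rewrite setTI; exact: caratheodory_measurable_mu_ext. Qed.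

Lemma ge0_integral_completion (D : set T) (f : T -> \bar R) : measurable D ->
  measurable_fun D f -> (forall x, D x -> 0 <= f x) ->
  \int[nu]_(x in D) f x = \int[mu]_(x in D) f x.
Proof.
move=> mD mf f0.
have := ge0_integral_pushforward measurable_cara_id nu mD mf
  (fun x xD => f0 x (set_mem xD)).
rewrite preimage_id => <-; apply/esym.
apply: eq_measure_integral; first exact: measurable_cara_id.
by move=> mid A mA _; apply/esym; exact: (measurable_mu_extE mu mA).
Qed.

Lemma integral_completion (D : set T) (f : T -> \bar R) : measurable D ->
  measurable_fun D f ->
  \int[nu]_(x in D) f x = \int[mu]_(x in D) f x.
Proof.
move=> mD mf.
have E := integralE mu D f; rewrite [RHS]E {E}.
have E := integralE nu D f; rewrite [LHS]E {E}.
congr (_ - _); apply: ge0_integral_completion => //.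
- exact: measurable_funepos.
- exact: measurable_funeneg.
Qed.

End completion.

(** Immediate from the definition of the integral as a supremum over simple
    functions below the integrand. It serves to bound the discrepancy of Omega by a
    Borel function. *)
Lemma le_integral_ge0 d (T : measurableType d) (R : realType)
    (mu : {measure set T -> \bar R}) (D : set T) (f g : T -> \bar R) :
  (forall x, D x -> 0 <= f x)%E -> (forall x, D x -> f x <= g x)%E ->
  (\int[mu]_(x in D) f x <= \int[mu]_(x in D) g x)%E.
Proof.
move=> f0 fg; have g0 x : D x -> (0 <= g x)%E.
  by move=> Dx; exact: le_trans (f0 _ Dx) (fg _ Dx).
rewrite !ge0_integralE//; apply: ereal_sup_le => _ [h /= hf <-].
exists h => // x; apply: le_trans (hf x) _.
by rewrite /patch; case: ifPn => // /set_mem; exact: fg.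
Qed.

Section borel_model.
Context (R : realType) (d : nat).
Local Notation T := (measurableTypeR R).
Local Notation borel := (borel_lebesgue R d).
Variable Omega : set (d.-tuple R).
Hypotheses (Omega_cube : Omega `<=` unit_cube R d)
  (Omega_measurable : lebesgue_measurable Omega).

(** E replaces Omega, and the null set Z covers the points where they differ. *)
Definition borel_model (E Z : set (d.-tuple T)) :=
  [/\ measurable E, measurable Z, E `<=` unit_cube R d & torus R d Z = 0%E] /\
  (Omega `<=` E /\ E `\` Omega `<=` Z).

Lemma outer_unit_cube : ((borel^*)%mu (unit_cube R d) = 1)%E.
Proof.
exact: (etrans (measurable_mu_extE borel (@measurable_unit_cube R d))
  (borel_lebesgue_unit_cube R d)).
Qed.

Lemma ex_borel_model : exists E Z, borel_model E Z.
Proof.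
have mQ := @measurable_unit_cube R d.
have Ooo : ((borel^*)%mu Omega < +oo)%E.
  apply: (@le_lt_trans _ _ ((borel^*)%mu (unit_cube R d))); first exact: le_mu_ext.
  by rewrite outer_unit_cube ltry.
have [E [Z [mE mZ Z0 OE EZ]]] := borel_approx Omega_measurable Ooo.
exists (E `&` unit_cube R d), Z; split; split => //.
- exact: measurableI.
- apply/eqP; rewrite torusE -measure_le0 -Z0; apply: le_measure; rewrite ?inE//.
  exact: measurableI.
- by move=> x Ox; split; [exact: OE|exact: Omega_cube].
- by move=> x [[Ex _] nOx]; exact: EZ.
Qed.

Variables (E Z : set (d.-tuple T)).
Hypothesis EZ : borel_model E Z.

Lemma bmint_lebesgue (g : d.-tuple T -> R) : bounded_measurable g ->
  \int[lebesgue R d]_(x in Omega) g x = \int[torus R d]_x (\1_E x * g x).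
Proof.
have [[mE mZ EQ Z0] [OE EOZ]] := EZ.
move=> bg; have mQ := @measurable_unit_cube R d.
have mD : measurable (E `\` (Z `&` unit_cube R d)).
  by apply: measurableD => //; exact: measurableI.
have OD : Omega `\` (Z `&` unit_cube R d) = E `\` (Z `&` unit_cube R d).
  apply/seteqP; split => x [h1 h2]; split => //; first exact: OE.
  apply: contrapT => nOx; apply: h2; split; last exact: EQ.
  exact: EOZ.
have bI : bounded_measurable (fun x => \1_E x * g x : R).
  by apply: bmM => //; exact: bm_indic.
rewrite (bmint_off_null mZ Z0)//.
have mN : measurable (Z `&` unit_cube R d) by exact: measurableI.
have mcara (A : set (d.-tuple T)) : measurable A -> (borel^*)%mu.-cara.-measurable A.
  exact: caratheodory_measurable_mu_ext.
have mg : measurable_fun setT g by case: bg.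
have mgc : measurable_fun setT (fun x : caratheodory_type (borel^*)%mu => g x).
  exact: (measurableT_comp mg (@measurable_cara_id _ _ _ borel)).
rewrite /Rintegral; congr fine.
transitivity (\int[lebesgue R d]_(x in Omega `\` (Z `&` unit_cube R d)) (g x)%:E)%E.
  apply: negligible_integral => //.
  - exact: mcara.
  - apply: measurable_bounded_integrable => //.
    + apply: (@le_lt_trans _ _ (lebesgue R d (unit_cube R d))).
        by apply: le_measure => //; rewrite inE//; exact: mcara.
      by rewrite [X in (X < _)%E]outer_unit_cube ltry.
    + exact: measurable_funTS.
    + have [_ [M gM]] := bg.
      exists M; split; [exact: num_real|move=> z Mz x _].
      exact: le_trans (gM x) (ltW Mz).
  - exact: (etrans (measurable_mu_extE borel mN) Z0).
rewrite OD.
transitivity (\int[borel]_(x in E `\` (Z `&` unit_cube R d)) (g x)%:E)%E.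
  apply: integral_completion => //.
  by apply/measurable_EFinP; exact: measurable_funTS.
transitivity (\int[torus R d]_(x in E `\` (Z `&` unit_cube R d)) (g x)%:E)%E.
  apply: eq_measure_integral => A mA AE.
  have AQ : A `&` unit_cube R d = A by apply: setIidl => x /AE [/EQ].
  exact: (esym (congr1 borel AQ)).
rewrite [LHS]integral_mkcond [RHS]integral_mkcond.
apply: eq_integral => x _.
rewrite /patch indicE; case: ifPn => [/set_mem [Ex nZ]|h].
  rewrite (mem_set Ex) /= mul1r.
  by rewrite mem_set// => Zx; apply: nZ; split => //; exact: EQ.
case: ifPn => // /set_mem nZ.
have /negP xE : x \notin E.
  apply: contra h => /set_mem Ex; apply/mem_set; split => // -[//].
by case: (boolP (x \in E)) => // _; rewrite /= mul0r.
Qed.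

Lemma fine_lebesgue : fine (lebesgue R d Omega) = \int[torus R d]_x \1_E x.
Proof.
have := bmint_lebesgue (bm_cst _ 1).
under [in RHS]eq_Rintegral do rewrite mulr1.
by move=> <-; rewrite Rintegral_cst// mul1r.
Qed.

Definition ivec (m : d.-tuple int) : d.-tuple R := [tuple (tnth m i)%:~R | i < d].

Lemma dotp_ivec m x : dotp (ivec m) x = idot m x.
Proof. by apply: eq_bigr => i _; rewrite tnth_mktuple. Qed.

Lemma normc_fourier_indic m :
  ComplexField.Normc.normc (fourier_indic Omega (ivec m)) ^+ 2 =
  tcos \1_E m ^+ 2 + tsin \1_E m ^+ 2.
Proof.
rewrite /ComplexField.Normc.normc /fourier_indic /complex_integral /=.
rewrite sqr_sqrtr ?addr_ge0 ?sqr_ge0//.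
have mid := @measurable_idot R d m.
have h1 : \int[lebesgue R d]_(x in Omega) cos (- (2 * pi * dotp (ivec m) x)) =
    tcos \1_E m.
  under eq_Rintegral do rewrite cosN dotp_ivec.
  by rewrite (bmint_lebesgue (bm_ecos mid)).
have h2 : \int[lebesgue R d]_(x in Omega) sin (- (2 * pi * dotp (ivec m) x)) =
    - tsin \1_E m.
  under eq_Rintegral do rewrite sinN dotp_ivec -mulN1r.
  rewrite (bmint_lebesgue (bmZ _ (bm_esin mid))).
  have [[mE _ _ _] _] := EZ.
  under eq_Rintegral do rewrite mulrCA.
  by rewrite bmintZ ?mulN1r//; exact: bm_tsin (bm_indic _ mE).
by rewrite h1 h2 sqrrN.
Qed.

(** As Omega lies in the cube, the only point of the class of z + x that may
    belong to it is the folded one. *)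
Lemma torus_translateE (z x : d.-tuple R) :
  torus_translate Omega x z <-> Omega (fold_shift z x).
Proof.
split=> [[w Ow hw]|Of].
  rewrite (_ : fold_shift z x = w)//; apply: eq_from_tnth => i.
  rewrite tnth_mktuple; have /intrP[k hk] := hw i.
  rewrite (@fold1_unique _ _ k) addrC -hk; first by ring.
  rewrite (_ : - _ + _ = tnth w i); first exact: (Omega_cube Ow).
  by ring.
exists (fold_shift z x) => // i; rewrite tnth_mktuple addrC.
by rewrite [tnth z i + _]addrC addrC fold1_int.
Qed.

Definition model_discrepancy (I : finType) (z : I -> d.-tuple R) (x : d.-tuple T) : R :=
  \sum_j \1_E (fold_shift (z j) x) - #|I|%:R * \int[torus R d]_x \1_E x.

Lemma bm_model_discrepancy (I : finType) (z : I -> d.-tuple R) :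
  bounded_measurable (model_discrepancy z).
Proof.
have [[mE _ _ _] _] := EZ.
apply: bmB (bm_cst _ _); apply: bm_sum => j.
exact: bm_fold_shift (bm_indic _ mE).
Qed.

(** The two discrepancies agree except where some z_j + x folds into Z, and
    translations preserve null sets. *)
Lemma integral_discrepancy_le N (z : 'I_N -> d.-tuple R) :
  (\int[lebesgue R d]_(x in unit_cube R d) (`|discrepancy Omega z x| ^+ 2)%:E <=
   (\int[torus R d]_x model_discrepancy z x ^+ 2)%:E)%E.
Proof.
have [[mE mZ EQ Z0] [OE EOZ]] := EZ.
have mQ := @measurable_unit_cube R d.
pose F j : set (d.-tuple T) := fold_shift (z j) @^-1` Z.
pose W := \big[setU/set0]_j F j.
have [mW W0] : measurable W /\ torus R d W = 0%E.
  apply: (big_ind (fun A => measurable A /\ torus R d A = 0%E)).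
  - by split => //; exact: measure0.
  - move=> A B [mA A0] [mB B0]; split; first exact: measurableU.
    exact: null_set_setU.
  - move=> j _; split; last by rewrite torus_shift.
    by rewrite -[X in measurable X]setTI; exact: measurable_fold_shift.
have FW j : F j `<=` W by rewrite /W (bigD1 j)//= => x; left.
have mWQ : measurable (W `&` unit_cube R d) by exact: measurableI.
pose g x : \bar R := (model_discrepancy z x ^+ 2)%:E.
have g0 x : (0 <= g x)%E by rewrite lee_fin sqr_ge0.
have mg : measurable_fun setT g.
  by apply/measurable_EFinP; case: (bm_sqr (bm_model_discrepancy z)).
(* A Borel majorant of the squared discrepancy with the integral of g. *)
pose h x : \bar R := if x \in W then +oo%E else g x.
have mh : measurable_fun setT h.
  apply: measurable_fun_ifT => //.
  apply: (measurable_fun_bool true); rewrite setTI (_ : _ @^-1` _ = W)//.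
  by apply/seteqP; split => x /=; [move/set_mem|move/mem_set].
have h0 x : (0 <= h x)%E by rewrite /h; case: ifP => // _.
apply: (@le_trans _ _ (\int[lebesgue R d]_(x in unit_cube R d) h x)%E).
  apply: le_integral_ge0 => x Qx; first by rewrite lee_fin sqr_ge0.
  rewrite /h; case: ifPn => [_|]; first by rewrite leey.
  move=> /negP xW; rewrite lee_fin real_normK ?num_real//.
  suff -> : discrepancy Omega z x = model_discrepancy z x by [].
  rewrite /discrepancy /model_discrepancy card_ord fine_lebesgue.
  congr (_ - _); apply: eq_bigr => j _; rewrite !indicE; congr (nat_of_bool _)%:R.
  apply/idP/idP => /set_mem.
    by move=> /torus_translateE /OE /mem_set.
  move=> Ex; apply/mem_set/torus_translateE; apply: contrapT => nO.
  by apply: xW; apply/mem_set; apply: (FW j); exact: EOZ.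
rewrite integral_completion//; last exact: measurable_funTS.
rewrite (ge0_negligible_integral mWQ mQ)//; last exact: measurable_funTS.
rewrite EFin_bmint; last exact: bm_sqr (bm_model_discrepancy z).
pose D := unit_cube R d `\` (W `&` unit_cube R d).
have mD : measurable D by exact: measurableD.
apply: (@le_trans _ _ (\int[torus R d]_(x in D) g x)%E); last first.
  by apply: ge0_subset_integral.
rewrite le_eqVlt; apply/orP; left; apply/eqP.
transitivity (\int[borel]_(x in D) g x)%E.
  apply: eq_integral => x /set_mem [Qx nW]; rewrite /h ifF//.
  by apply/negP => /set_mem Wx; apply: nW.
apply: eq_measure_integral => A mA AD.
have AQ : A `&` unit_cube R d = A by apply: setIidl => x /AD [].
exact: (esym (congr1 borel AQ)).
Qed.

End borel_model.

(** * Fourier coefficients of the discrepancy *)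

Section torus_coefficients.
Context (R : realType) (d : nat).
Local Notation T := (measurableTypeR R).
Implicit Types (m : d.-tuple int) (z x : d.-tuple R).

Definition izero : d.-tuple int := [tuple 0 | i < d].

(** Folding changes the coordinates by integers, and the frequency is integral. *)
Lemma idot_fold_shift m z x : exists k : int,
  idot m (fold_shift z x) = idot m x + idot m z + k%:~R.
Proof.
exists (- \sum_(i < d) tnth m i * Num.floor (tnth x i + tnth z i + 2^-1)).
rewrite mulrNz rmorph_sum -big_split/= -sumrB; apply: eq_bigr => i _.
by rewrite tnth_mktuple /fold1 intrM; ring.
Qed.

Lemma ecos_idot_shift m z x :
  ecos (idot m x) = ecos (idot m (fold_shift z x) - idot m z).
Proof.
have [k ->] := idot_fold_shift m z x.
by rewrite -[LHS](ecosDint _ k); congr ecos; ring.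
Qed.

Lemma esin_idot_shift m z x :
  esin (idot m x) = esin (idot m (fold_shift z x) - idot m z).
Proof.
have [k ->] := idot_fold_shift m z x.
by rewrite -[LHS](esinDint _ k); congr esin; ring.
Qed.

Lemma bm_ecos_idot m : bounded_measurable (fun x : d.-tuple T => ecos (idot m x)).
Proof. by apply: bm_ecos; exact: measurable_idot. Qed.
Lemma bm_esin_idot m : bounded_measurable (fun x : d.-tuple T => esin (idot m x)).
Proof. by apply: bm_esin; exact: measurable_idot. Qed.

Lemma idot_half m : m != izero -> exists z, idot m z = 2^-1.
Proof.
move=> m0; have [i mi0] : exists i, tnth m i != 0.
  apply/existsP; apply: contraNT m0 => /existsPn h.
  apply/eqP/eq_from_tnth => i; rewrite tnth_mktuple; apply/eqP.
  by have := h i; rewrite negbK.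
exists [tuple if j == i then (2 * (tnth m i)%:~R)^-1 else 0 | j < d].
rewrite /idot (bigD1 i)//= big1 ?addr0 => [|j ji]; rewrite tnth_mktuple.
  by rewrite eqxx invfM mulrCA mulfV ?mulr1// intr_eq0.
by rewrite (negbTE ji) mulr0.
Qed.

(** As on the circle: some translation moves the phase by half a period. *)
Lemma torus_ecos m : m != izero -> \int[torus R d]_x ecos (idot m x) = 0.
Proof.
move=> /idot_half[z hz].
have := bmint_fold_shift z (bm_ecos_idot m).
under [LHS in LHS = _ -> _]eq_Rintegral.
  move=> x _; rewrite -[idot m _](subrK (idot m z)) ecosD -ecos_idot_shift hz.
  rewrite ecos_half esin_half mulr0 subr0 mulrN1 -mulN1r; over.
rewrite bmintZ; last exact: bm_ecos_idot.
by move: (Rintegral _ _ _) => I; lra.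
Qed.

Lemma torus_esin m : m != izero -> \int[torus R d]_x esin (idot m x) = 0.
Proof.
move=> /idot_half[z hz].
have := bmint_fold_shift z (bm_esin_idot m).
under [LHS in LHS = _ -> _]eq_Rintegral.
  move=> x _; rewrite -[idot m _](subrK (idot m z)) esinD -esin_idot_shift hz.
  rewrite ecos_half esin_half mulr0 addr0 mulrN1 -mulN1r; over.
rewrite bmintZ; last exact: bm_esin_idot.
by move: (Rintegral _ _ _) => I; lra.
Qed.

Lemma tcos_shift (f : d.-tuple T -> R) m z : bounded_measurable f ->
  tcos (fun x => f (fold_shift z x)) m =
  tcos f m * ecos (idot m z) + tsin f m * esin (idot m z).
Proof.
move=> bf; rewrite /tcos; under eq_Rintegral do rewrite (ecos_idot_shift _ z).
have bc := bm_tcos m bf; have bs := bm_tsin m bf.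
have bE : bounded_measurable (fun y : d.-tuple T => f y * ecos (idot m y - idot m z)).
  apply: bmM => //; apply: bm_ecos; apply: measurable_funB => //; exact: measurable_idot.
rewrite (bmint_fold_shift z bE).
under eq_Rintegral do rewrite ecosB mulrDr !mulrA.
rewrite bmintD; [|exact: bmM bc (bm_cst _ _)|exact: bmM bs (bm_cst _ _)].
by rewrite !bmintZr.
Qed.

Lemma tsin_shift (f : d.-tuple T -> R) m z : bounded_measurable f ->
  tsin (fun x => f (fold_shift z x)) m =
  tsin f m * ecos (idot m z) - tcos f m * esin (idot m z).
Proof.
move=> bf; rewrite /tsin; under eq_Rintegral do rewrite (esin_idot_shift _ z).
have bc := bm_tcos m bf; have bs := bm_tsin m bf.
have bE : bounded_measurable (fun y : d.-tuple T => f y * esin (idot m y - idot m z)).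
  apply: bmM => //; apply: bm_esin; apply: measurable_funB => //; exact: measurable_idot.
rewrite (bmint_fold_shift z bE).
under eq_Rintegral do rewrite esinB mulrBr !mulrA.
rewrite bmintB; [|exact: bmM bs (bm_cst _ _)|exact: bmM bc (bm_cst _ _)].
by rewrite !bmintZr.
Qed.

Lemma tcos_sum (I : finType) (F : I -> d.-tuple T -> R) m :
  (forall j, bounded_measurable (F j)) ->
  tcos (fun x => \sum_j F j x) m = \sum_j tcos (F j) m.
Proof.
move=> bF; rewrite /tcos; under eq_Rintegral do rewrite big_distrl/=.
by rewrite bmint_sum// => j; exact: bm_tcos.
Qed.

Lemma tsin_sum (I : finType) (F : I -> d.-tuple T -> R) m :
  (forall j, bounded_measurable (F j)) ->
  tsin (fun x => \sum_j F j x) m = \sum_j tsin (F j) m.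
Proof.
move=> bF; rewrite /tsin; under eq_Rintegral do rewrite big_distrl/=.
by rewrite bmint_sum// => j; exact: bm_tsin.
Qed.

Variables (E : set (d.-tuple T)) (mE : measurable E).
Variables (I : finType) (z : I -> d.-tuple R).
Local Notation D := (model_discrepancy E z).
Local Notation f := (\1_E : d.-tuple T -> R).

(** The squared modulus of the exponential sum over the points at frequency m. *)
Definition expsum_sqr (J : finType) (y : J -> d.-tuple R) m : R :=
  (\sum_j ecos (idot m (y j))) ^+ 2 + (\sum_j esin (idot m (y j))) ^+ 2.

Let bf : bounded_measurable f. Proof. exact: bm_indic. Qed.
Let bF j : bounded_measurable (fun x => f (fold_shift (z j) x)).
Proof. exact: bm_fold_shift. Qed.

(** Translating a function multiplies its coefficient by a value of the character,
    so the coefficient of the sum of translates is a product; the constant term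
    has no coefficient at a nonzero frequency. *)
Lemma discrepancy_coef m : m != izero ->
  tcos D m ^+ 2 + tsin D m ^+ 2 = (tcos f m ^+ 2 + tsin f m ^+ 2) * expsum_sqr z m.
Proof.
move=> m0; pose c : R := #|I|%:R * \int[torus R d]_x f x.
have bS : bounded_measurable (fun x => \sum_j f (fold_shift (z j) x)).
  exact: bm_sum bF.
have bc : bounded_measurable (fun _ : d.-tuple T => c) by exact: bm_cst.
have -> : tcos D m = \sum_j tcos (fun x => f (fold_shift (z j) x)) m.
  rewrite -tcos_sum//; apply: etrans (tcosB m bS bc) _.
  rewrite [X in _ - X](_ : _ = 0) ?subr0//.
  by rewrite /tcos bmintZ ?torus_ecos ?mulr0//; exact: bm_ecos_idot.
have -> : tsin D m = \sum_j tsin (fun x => f (fold_shift (z j) x)) m.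
  rewrite -tsin_sum//; apply: etrans (tsinB m bS bc) _.
  rewrite [X in _ - X](_ : _ = 0) ?subr0//.
  by rewrite /tsin bmintZ ?torus_esin ?mulr0//; exact: bm_esin_idot.
under eq_bigr do rewrite tcos_shift//.
under [X in _ + X ^+ 2]eq_bigr do rewrite tsin_shift//.
rewrite /expsum_sqr big_split/= sumrB -!big_distrr/=; ring.
Qed.

Lemma idot_izero x : idot izero x = 0.
Proof. by rewrite /idot big1// => i _; rewrite tnth_mktuple mul0r. Qed.

Lemma discrepancy_coef0 : tcos D izero ^+ 2 + tsin D izero ^+ 2 = 0.
Proof.
have -> : tsin D izero = 0.
  rewrite /tsin; under eq_Rintegral do rewrite idot_izero esin0 mulr0.
  by rewrite Rintegral_cst// mul0r.
have -> : tcos D izero = 0.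
  rewrite /tcos; under eq_Rintegral do rewrite idot_izero ecos0 mulr1.
  rewrite /model_discrepancy bmintB; [|exact: bm_sum|exact: bm_cst].
  rewrite bmint_sum// Rintegral_cst//.
  under eq_bigr do rewrite bmint_fold_shift//.
  rewrite sumr_const [X in fine X](_ : _ = 1%E); last exact: torus_setT.
  by rewrite mulr1 mulr_natl subrr.
by rewrite expr0n/= addr0.
Qed.

Theorem discrepancy_spectral_bound :
  ((\int[torus R d]_x D x ^+ 2)%:E <=
   \esum_(m in [set m | m != izero])
     ((tcos f m ^+ 2 + tsin f m ^+ 2) * expsum_sqr z m)%:E)%E.
Proof.
have bD : bounded_measurable D.
  by apply: bmB (bm_cst _ _); exact: bm_sum.
have := parseval_torus bD (bm_cst _ 0).
under eq_Rintegral do rewrite expr0n/= addr0.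
move=> /le_trans; apply.
rewrite [leRHS]esum_mkcond; apply: le_esum => m _.
have -> : tcos (fun=> 0 : R) m = 0.
  rewrite /tcos; under eq_Rintegral do rewrite mul0r.
  by rewrite Rintegral_cst// mul0r.
have -> : tsin (fun=> 0 : R) m = 0.
  rewrite /tsin; under eq_Rintegral do rewrite mul0r.
  by rewrite Rintegral_cst// mul0r.
rewrite addr0 sub0r sqrrN.
have [->|m0] := eqVneq m izero.
  rewrite discrepancy_coef0 ifF//; apply/negbTE/negP => /set_mem /=.
  by rewrite eqxx.
by rewrite mem_set// discrepancy_coef.
Qed.

End torus_coefficients.

(** * Exponential sums over the point set *)

Section exponential_sums.
Context (R : realType).

Definition eexp (x : R) : R[i] := Complex (ecos x) (esin x).

Lemma eexpD x y : eexp (x + y) = eexp x * eexp y.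
Proof. by rewrite /eexp ecosD esinD; congr Complex; rewrite addrC. Qed.

Lemma eexp0 : eexp 0 = 1.
Proof. by rewrite /eexp ecos0 esin0. Qed.

Lemma eexp_sum (I : finType) (F : I -> R) : eexp (\sum_i F i) = \prod_i eexp (F i).
Proof. by apply: (big_morph eexp); [exact: eexpD|exact: eexp0]. Qed.

Lemma eexp_int (k : int) : eexp k%:~R = 1.
Proof. by rewrite /eexp ecos_int esin_int. Qed.

Lemma eexpX x n : eexp (x * n%:R) = eexp x ^+ n.
Proof.
elim: n => [|n IH]; first by rewrite mulr0 eexp0 expr0.
by rewrite -natr1 mulrDr mulr1 eexpD IH exprSr.
Qed.

(** Between two consecutive integers the cosine is strictly below 1. *)
Lemma eexp_eq1 (x : R) : eexp x = 1 -> x \is a Num.int.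
Proof.
move=> [+ _] => h.
have /andP[f0 f1] := Num.Theory.floor_itv x.
have h' : ecos (x - (Num.floor x)%:~R) = 1 by rewrite -mulrNz ecosDint.
have [f0'|] := ltP 0 (x - (Num.floor x)%:~R).
  have : ecos (x - (Num.floor x)%:~R) < 1.
    by apply: ecos_lt1_strict; rewrite f0'/= ltrBlDl -intrD1.
  by rewrite h' ltxx.
rewrite subr_le0 => f0'.
have -> : x = (Num.floor x)%:~R by apply/eqP; rewrite eq_le f0 f0'.
exact: intr_int.
Qed.

Lemma geometric_eexp (q : nat) (c : int) : (0 < q)%N ->
  \sum_(t < q) eexp (c%:~R / q%:R * t%:R) != 0 -> (q%:Z %| c)%Z.
Proof.
move=> q0; under eq_bigr do rewrite eexpX.
have qR : q%:R != 0 :> R by rewrite pnatr_eq0 -lt0n.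
have [E1|E1] := eqVneq (eexp (c%:~R / q%:R)) 1.
  move=> _; have /intrP[k hk] := eexp_eq1 E1.
  apply/dvdzP; exists k; apply: (@intr_inj R).
  by rewrite intrM -hk mulfVK.
have := subrX1 (eexp (c%:~R / q%:R)) q.
rewrite -eexpX mulfVK// eexp_int subrr => /esym/eqP.
by rewrite mulf_eq0 subr_eq0 (negbTE E1)/= => /eqP ->; rewrite eqxx.
Qed.

Lemma expsum_sqrE d (J : finType) (y : J -> d.-tuple R) m :
  expsum_sqr y m != 0 -> \sum_j eexp (idot m (y j)) != 0.
Proof.
apply: contraNN => /eqP.
have -> : \sum_j eexp (idot m (y j)) =
    Complex (\sum_j ecos (idot m (y j))) (\sum_j esin (idot m (y j))).
  by elim/big_rec3: _ => // j a b c _ ->.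
by move=> [h1 h2]; rewrite /expsum_sqr h1 h2 expr0n/= addr0.
Qed.

(** Expanded as a double sum of cosines of differences. *)
Lemma expsum_sqr_le d (J : finType) (y : J -> d.-tuple R) m :
  expsum_sqr y m <= #|J|%:R ^+ 2.
Proof.
have -> : expsum_sqr y m = \sum_j \sum_l ecos (idot m (y j) - idot m (y l)).
  rewrite /expsum_sqr !expr2 !big_distrl/= -big_split/=; apply: eq_bigr => k _.
  rewrite !big_distrr/= -big_split/=; apply: eq_bigr => l _.
  by rewrite ecosB.
apply: (@le_trans _ _ (\sum_(j : J) \sum_(l : J) 1)).
  apply: ler_sum => j _; apply: ler_sum => l _.
  exact: le_trans (ler_norm _) (ecos_max _).
by rewrite !sumr_const -[leLHS]mulr_natr expr2.
Qed.

Lemma expsum_sqr_fold d (J : finType) (y : J -> d.-tuple R) m (o : d.-tuple R) :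
  idot m o = 0 ->
  expsum_sqr (fun j => fold_shift o (y j)) m = expsum_sqr y m.
Proof.
move=> mo; rewrite /expsum_sqr; congr (_ ^+ 2 + _ ^+ 2); apply: eq_bigr => j _.
  by rewrite [RHS](ecos_idot_shift m o) mo subr0.
by rewrite [RHS](esin_idot_shift m o) mo subr0.
Qed.

End exponential_sums.

Section points.
Context (R : realType) (d' : nat).
Let d := d'.+1.
Variables (w : 'I_d -> int) (i0 : 'I_d) (A q : nat) (b : int).
Hypotheses (A_gt0 : (0 < A)%N) (q_gt0 : (0 < q)%N) (wb : (q%:Z %| w i0 * b - 1)%Z).

Definition point_index : finType := ({ffun 'I_d -> 'I_A} * {ffun 'I_d' -> 'I_q})%type.

(** Residues modulo q orthogonal to w: all coordinates but the i0-th are free, and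
    the latter is solved for with the inverse b of the i0-th entry of w. *)
Definition residue (s : {ffun 'I_d' -> 'I_q}) (i : 'I_d) : int :=
  if unlift i0 i is Some j then (s j)%:Z
  else - b * \sum_(j < d') w (lift i0 j) * (s j)%:Z.

(** These points, taken modulo 1, run through the annihilator of the lattice of
    vectors A (k w + q n): multiplied by A q they are q t + r with t arbitrary and
    r orthogonal to w modulo q. *)
Definition raw_point (ts : point_index) : d.-tuple R :=
  [tuple (ts.1 i)%:R / A%:R + (residue ts.2 i)%:~R / (A%:R * q%:R) | i < d].

Lemma card_point_index : #|{: point_index}| = (A ^ d * q ^ d')%N.
Proof. by rewrite card_prod !card_ffun !card_ord. Qed.

(** The coefficient, in the phase at frequency m, of the j-th free residue once the
    dependent one has been eliminated. *)
Definition dual_coef (m : d.-tuple int) (j : 'I_d') : int :=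
  tnth m (lift i0 j) - b * w (lift i0 j) * tnth m i0.

Lemma idot_raw_point (m : d.-tuple int) ts :
  idot m (raw_point ts) =
  \sum_i (tnth m i)%:~R / A%:R * (ts.1 i)%:R +
  \sum_j (dual_coef m j)%:~R / (A%:R * q%:R) * (ts.2 j)%:R.
Proof.
rewrite /idot; under eq_bigr do rewrite tnth_mktuple mulrDr.
rewrite big_split/=; congr (_ + _); first by apply: eq_bigr => i _; ring.
rewrite (bigD1_ord i0)//= /residue unlift_none.
under eq_bigr do rewrite liftK.
rewrite mulr_sumr rmorph_sum/= mulr_suml mulr_sumr -big_split/=.
apply: eq_bigr => j _; rewrite /dual_coef !intrM intrB !intrM mulrNz -!pmulrn.
ring.
Qed.

Lemma expsum_raw_point (m : d.-tuple int) :
  \sum_ts eexp (idot m (raw_point ts)) =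
  (\prod_(i < d) \sum_(t < A) eexp ((tnth m i)%:~R / A%:R * t%:R)) *
  (\prod_(j < d') \sum_(s < q) eexp ((dual_coef m j)%:~R / (A%:R * q%:R) * s%:R)) :> R[i].
Proof.
under eq_bigr do rewrite idot_raw_point eexpD !eexp_sum.
rewrite !bigA_distr_bigA/= big_distrl/=.
under [RHS]eq_bigr do rewrite big_distrr/=.
by rewrite pair_big.
Qed.

(** All factors of [expsum_raw_point] are nonzero geometric sums. Those in t say
    that A divides m; for m = A m' the others say that q divides the vector
    m' - (b m'_i0) w off the coordinate i0, and at i0 this holds by the choice
    of b. *)
Lemma raw_point_dual (m : d.-tuple int) : expsum_sqr raw_point m != 0 ->
  exists (k : int) (n : 'I_d -> int),
    forall i, tnth m i = A%:Z * (k * w i + q%:Z * n i).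
Proof.
move=> /expsum_sqrE; rewrite expsum_raw_point mulf_eq0 negb_or => /andP[h1 h2].
have /all_sig [m' hm'] i : {c : int | tnth m i = c * A%:Z}.
  apply: cid; apply/dvdzP; apply: (@geometric_eexp R _ _ A_gt0).
  by apply: contraNN h1 => /eqP h; apply/eqP; rewrite (bigD1 i)//= h mul0r.
have AR : A%:R != 0 :> R by rewrite pnatr_eq0 -lt0n.
have qR : q%:R != 0 :> R by rewrite pnatr_eq0 -lt0n.
have hc j : (q%:Z %| m' (lift i0 j) - b * w (lift i0 j) * m' i0)%Z.
  apply: (@geometric_eexp R _ _ q_gt0).
  apply: contraNN h2 => /eqP h; apply/eqP; rewrite (bigD1 j)//=.
  rewrite [X in X * _](_ : _ = 0) ?mul0r//.
  rewrite -[RHS]h; apply: eq_bigr => s _; congr (eexp (_ * _)).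
  rewrite (_ : dual_coef m j = (m' (lift i0 j) - b * w (lift i0 j) * m' i0) * A%:Z).
    by rewrite (intrM _ _ A) -pmulrn; field; rewrite AR qR.
  by rewrite /dual_coef !hm'; ring.
(* The vector m' is congruent modulo q to the multiple of w by b m'_i0. *)
have hd i : (q%:Z %| m' i - b * m' i0 * w i)%Z.
  case: (unliftP i0 i) => [j ->|->].
    by have := hc j; congr (_ %| _)%Z; ring.
  rewrite (_ : _ - _ = (w i0 * b - 1) * - m' i0); last by ring.
  exact: dvdz_mulr.
have /all_sig [n hn] i : {c : int | m' i - b * m' i0 * w i = c * q%:Z}.
  by apply: cid; apply/dvdzP.
exists (b * m' i0), n => i.
by rewrite hm' [q%:Z * _]mulrC -hn mulrC; congr (_ * _); ring.
Qed.

End points.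

(** * Inverse power sums over the integer lattice *)

Section lattice_sums.
Context (R : realType).

(** The step of a telescoping bound for the tail of the series: by Bernoulli,
    x^p (x + 2) <= (x + 1)^(p+1). *)
Lemma inv_pow_step (x : R) p : 1 <= x -> (0 < p)%N ->
  (x + 1) ^- p.+1 <= x ^- p - (x + 1) ^- p.
Proof.
move=> x1 p0; have x0 : 0 < x by lra.
have y0 : 0 < x + 1 by lra.
have h : x ^+ p * (x + 2) <= (x + 1) ^+ p.+1.
  case: p p0 => // p _; rewrite !exprSr -!mulrA.
  apply: ler_pM; [exact: exprn_ge0 (ltW x0)|nra| |nra].
  by apply: lerXn2r; rewrite ?nnegrE; lra.
have E : (x + 1) ^- p = (x + 1) / (x + 1) ^+ p.+1.
  by rewrite exprS invfM mulrA mulfV ?mul1r// gt_eqF.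
rewrite lerBrDr E -[X in X + _]mul1r -mulrDl.
rewrite ler_pdivrMr ?exprn_gt0// ler_pdivlMl ?exprn_gt0//.
by rewrite (_ : 1 + (x + 1) = x + 2)//; ring.
Qed.

Lemma sum_inv_pow (a : R) p n : 1 <= a -> (0 < p)%N ->
  \sum_(k < n) (a + k%:R + 1) ^- p.+1 <= a ^- p - (a + n%:R) ^- p.
Proof.
move=> a1 p0; elim: n => [|n IH]; first by rewrite big_ord0 addr0 subrr.
rewrite big_ord_recr/=.
have h : 1 <= a + n%:R by have := ler0n R n; lra.
rewrite -[n.+1%:R]natr1 addrA.
apply: le_trans (lerD IH (inv_pow_step h p0)) _.
by rewrite addrA subrK.
Qed.

Lemma sum_inv_pow_le (a : R) p n : 1 <= a -> (0 < p)%N ->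
  \sum_(k < n) (a + k%:R + 1) ^- p.+1 <= a ^- p.
Proof.
move=> a1 p0; apply: le_trans (sum_inv_pow n a1 p0) _.
rewrite gerBl invr_ge0 exprn_ge0//.
by have := ler0n R n; lra.
Qed.

Lemma sum_inv_pow0_le (a : R) p n : 1 <= a -> (0 < p)%N ->
  \sum_(k < n) (a + k%:R) ^- p.+1 <= 2 * a ^- p.
Proof.
move=> a1 p0; have a0 : 0 < a by lra.
apply: (@le_trans _ _ (\sum_(k < n.+1) (a + k%:R) ^- p.+1)).
  rewrite big_ord_recr/= lerDl invr_ge0 exprn_ge0//.
  by have := ler0n R n; lra.
rewrite big_ord_recl/= addr0 mulr2n mulrDl mul1r lerD//.
  rewrite lef_pV2 ?posrE ?exprn_gt0// exprS.
  by rewrite ler_peMl// exprn_ge0// ltW.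
apply: le_trans (sum_inv_pow_le n a1 p0).
by apply: ler_sum => k _; rewrite /bump/= add1n -natr1 addrA.
Qed.

Lemma esum_int_inv_pow (a : R) p : 1 <= a -> (0 < p)%N ->
  (\esum_(k in [set: int]) ((a + `|k%:~R|) ^- p.+1)%:E <= (3 * a ^- p)%:E)%E.
Proof.
move=> a1 p0; set f := fun k : int => _.
have f0 k : (0 <= f k)%E.
  rewrite /f lee_fin invr_ge0 exprn_ge0//.
  by have := normr_ge0 (k%:~R : R); lra.
rewrite (esumID [set k : int | 0 <= k]); last by move=> k _; exact: f0.
rewrite !setTI.
have -> : [set k : int | 0 <= k] = Posz @` [set: nat].
  apply/seteqP; split => [[n|n]//= _|_ [n _ <-]//]; by exists n.
have -> : ~` (Posz @` [set: nat]) = Negz @` [set: nat].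
  apply/seteqP; split => [[n|n] h|_ [n _ <-] [m _]//]; last by exists n.
  by exfalso; apply: h; exists n.
rewrite !esum_image//; try by move=> x y _ _ [].
rewrite -!nneseries_esumT//; try by move=> n; exact: f0.
have -> : 3 * a ^- p = 2 * a ^- p + a ^- p by ring.
rewrite EFinD; apply: leeD.
  apply: lime_le; first by apply: is_cvg_nneseries => n _ _; exact: f0.
  apply: nearW => n; rewrite big_mkord /f sumEFin lee_fin.
  apply: le_trans (sum_inv_pow0_le n a1 p0).
  by apply: ler_sum => k _; rewrite ger0_norm.
apply: lime_le; first by apply: is_cvg_nneseries => n _ _; exact: f0.
apply: nearW => n; rewrite big_mkord /f sumEFin lee_fin.
apply: le_trans (sum_inv_pow_le n a1 p0).
apply: ler_sum => k _; rewrite NegzE mulrNz normrN.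
by rewrite -pmulrn normr_nat -natr1 addrA.
Qed.

Definition norm1 d (n : d.-tuple int) : R := \sum_(i < d) `|(tnth n i)%:~R|.

Lemma norm1_ge0 d (n : d.-tuple int) : 0 <= norm1 n.
Proof. by apply: sumr_ge0 => i _; exact: normr_ge0. Qed.

Lemma norm1_cons d k (n : d.-tuple int) : norm1 (icons (k, n)) = `|k%:~R| + norm1 n.
Proof.
rewrite /norm1 big_ord_recl; congr (_ + _).
by apply: eq_bigr => i _; rewrite tnthS.
Qed.

(** Summing over one coordinate costs a factor 3 and lowers the exponent by one. *)
Lemma esum_tuple_inv_pow d p (b : R) : 1 <= b -> (0 < p)%N ->
  (\esum_(n in [set: d.-tuple int]) ((b + norm1 n) ^- (d + p))%:E <=
   (3 ^+ d * b ^- p)%:E)%E.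
Proof.
move=> b1 p0; have b0 : 0 < b by lra.
have F0 e q (n : e.-tuple int) : (0 <= ((b + norm1 n) ^- q)%:E)%E.
  by rewrite lee_fin invr_ge0 exprn_ge0// addr_ge0 ?norm1_ge0// ltW.
elim: d => [|d IH].
  rewrite (_ : [set: _] = [set [tuple]]); last first.
    by apply/seteqP; split => // x _; rewrite /= tuple0.
  by rewrite esum_set1 ?F0// /norm1 big_ord0 addr0 expr0 mul1r.
pose phi (n : d.+1.-tuple int) : d.-tuple int * int := ([tuple of behead n], thead n).
have phiK n : icons ((phi n).2, (phi n).1) = n.
  by rewrite /phi/= /icons/= [RHS]tuple_eta.
pose a (x : d.-tuple int * int) : \bar R := ((b + norm1 x.1 + `|x.2%:~R|) ^- (d.+1 + p))%:E.
have a0 x : (0 <= a x)%E.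
  rewrite lee_fin invr_ge0 exprn_ge0// addr_ge0 ?normr_ge0//.
  by rewrite addr_ge0 ?norm1_ge0// ltW.
rewrite (_ : \esum_(n in _) _ =
    \esum_(n in [set: d.+1.-tuple int]) a (phi n))%E; last first.
  apply: eq_esum => n _; rewrite -{1}[n]phiK norm1_cons /a.
  by congr ((_ ^- _)%:E); rewrite [`|_| + _]addrC addrA.
apply: (@le_trans _ _ (\esum_(x in [set: d.-tuple int * int]) a x)%E).
  apply: (@esum_inj_le _ _ _ setT phi a) => // x y _ _ h.
  by rewrite -[x]phiK h phiK.
apply: (@le_trans _ _ (\esum_(n in [set: d.-tuple int])
    \esum_(k in [set: int]) a (n, k))%E).
  rewrite esum_esum; last by move=> i j _ _; exact: a0.
  rewrite (_ : _ `*`` _ = setT); last by apply/seteqP; split.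
  by apply: le_esum => -[].
apply: (@le_trans _ _ (\esum_(n in [set: d.-tuple int])
    (3%:E * ((b + norm1 n) ^- (d + p))%:E))%E).
  apply: le_esum => n _; rewrite -EFinM.
  have h1 : 1 <= b + norm1 n by have := norm1_ge0 n; lra.
  have h2 : (0 < d + p)%N by rewrite addn_gt0 p0 orbT.
  exact: (esum_int_inv_pow h1 h2).
apply: le_trans (esumZ_le _ _ _) _ => //.
rewrite exprS -mulrA EFinM; apply: lee_wpmul2l => //.
Qed.

End lattice_sums.

(** * The dual lattice *)

Section vectors.
Context (R : realType) (d : nat).
Implicit Types (x v : d.-tuple R) (m w : d.-tuple int).

Definition norm2 x : R := Num.sqrt (dotp x x).

Lemma dotp_ge0 x : 0 <= dotp x x.
Proof. by apply: sumr_ge0 => i _; rewrite -expr2 sqr_ge0. Qed.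

Lemma norm2_sqr x : norm2 x ^+ 2 = dotp x x.
Proof. by rewrite sqr_sqrtr// dotp_ge0. Qed.

Lemma norm2_ge0 x : 0 <= norm2 x.
Proof. exact: sqrtr_ge0. Qed.

Lemma coord_le_norm2 x i : `|tnth x i| <= norm2 x.
Proof.
rewrite -sqrtr_sqr ler_wsqrtr// /dotp (bigD1 i)//= -expr2 lerDl.
by apply: sumr_ge0 => j _; rewrite -expr2 sqr_ge0.
Qed.

Lemma norm2_scale (a : R) x y : (forall i, tnth y i = a * tnth x i) ->
  norm2 y = `|a| * norm2 x.
Proof.
move=> yx; rewrite /norm2 -sqrtr_sqr -sqrtrM ?sqr_ge0//; congr Num.sqrt.
by rewrite /dotp big_distrr/=; apply: eq_bigr => i _; rewrite yx; ring.
Qed.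

(** Round the coordinates of n v: the error stays bounded while n grows. *)
Lemma integer_direction v (beta : R) : unit_sphere v -> 0 < beta < 1 ->
  exists w, beta * norm2 (ivec R w) < `|dotp (ivec R w) v|.
Proof.
move=> v1 /andP[b0 b1].
have vv : dotp v v = 1.
  by rewrite -norm2_sqr /norm2 v1 expr1n.
have vi i : `|tnth v i| <= 1 by rewrite -[leRHS]v1; exact: coord_le_norm2.
(* It suffices that beta (n + d) < n - d. *)
pose n : nat := (Num.truncn (2 * d%:R / (1 - beta))).+1.
have hn : 2 * d%:R < n%:R * (1 - beta).
  by rewrite -ltr_pdivrMr ?subr_gt0//; exact: Num.Theory.truncnS_gt.
exists [tuple Num.floor (n%:R * tnth v i) | i < d].
set w := [tuple _ | _ < _].
pose th i : R := n%:R * tnth v i - (tnth w i)%:~R.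
have th01 i : 0 <= th i <= 1.
  rewrite /th tnth_mktuple; have := Num.Theory.floor_itv (n%:R * tnth v i).
  by rewrite intrD1 => /andP[h1 h2]; apply/andP; split; lra.
have wE i : tnth (ivec R w) i = n%:R * tnth v i - th i.
  by rewrite !tnth_mktuple /th opprB addrC subrK tnth_mktuple.
have thv : `|\sum_i th i * tnth v i| <= d%:R.
  apply: le_trans (ler_norm_sum _ _ _) _.
  apply: (@le_trans _ _ (\sum_(i < d) 1)); last by rewrite sumr_const card_ord.
  apply: ler_sum => i _; rewrite normrM -[1]mulr1; apply: ler_pM => //.
  by have /andP[? ?] := th01 i; rewrite ger0_norm.
have hdot : dotp (ivec R w) v = n%:R - \sum_i th i * tnth v i.
  transitivity (n%:R * dotp v v - \sum_i th i * tnth v i); last by rewrite vv mulr1.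
  rewrite /dotp big_distrr/= -sumrB; apply: eq_bigr => i _.
  by rewrite wE; ring.
have hnorm : norm2 (ivec R w) <= n%:R + d%:R.
  rewrite -[leRHS]ger0_norm// -sqrtr_sqr; apply: ler_wsqrtr.
  have -> : dotp (ivec R w) (ivec R w) =
      n%:R ^+ 2 - 2 * n%:R * \sum_i th i * tnth v i + \sum_i th i ^+ 2.
    transitivity (n%:R ^+ 2 * dotp v v - 2 * n%:R * \sum_i th i * tnth v i +
      \sum_i th i ^+ 2); last by rewrite vv mulr1.
    rewrite /dotp !big_distrr/= -sumrB -big_split/=.
    by apply: eq_bigr => i _; rewrite wE; ring.
  have h2 : \sum_i th i ^+ 2 <= d%:R.
    apply: (@le_trans _ _ (\sum_(i < d) 1)); last by rewrite sumr_const card_ord.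
    by apply: ler_sum => i _; have /andP[? ?] := th01 i; rewrite expr_le1.
  have h3 : (d%:R : R) <= d%:R ^+ 2.
    by rewrite -natrX ler_nat; case: (d) => // e; rewrite leq_pmulr.
  have n0 : 0 <= n%:R :> R by [].
  by move: thv; rewrite ler_norml => /andP[t1 t2]; nra.
move: thv; rewrite ler_norml => /andP[t1 t2].
apply: lt_le_trans (ler_norm _); rewrite hdot.
have : beta * norm2 (ivec R w) <= beta * (n%:R + d%:R) by rewrite ler_wpM2l// ltW.
have d0 : 0 <= d%:R :> R by [].
by nra.
Qed.

End vectors.

Section dual_lattice.
Context (R : realType) (d : nat).
Variables (w : d.-tuple int) (i0 : 'I_d) (wi0 : tnth w i0 != 0).
Variables (A q : nat) (A_gt0 : (0 < A)%N) (q_gt0 : (0 < q)%N).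

Definition parallel (m : d.-tuple int) : Prop :=
  forall i l, tnth m i * tnth w l = tnth m l * tnth w i.

Definition in_dual (m : d.-tuple int) (k : int) (n : d.-tuple int) : Prop :=
  forall i, tnth m i = A%:Z * (k * tnth w i + q%:Z * tnth n i).

(** Depends on w only; it is the constant in [off_line_size]. *)
Definition transverse_const : R := d%:R + 2 * norm1 R w * (1 + norm1 R w).

Lemma coord_le_norm1 (n : d.-tuple int) i : `|(tnth n i)%:~R| <= norm1 R n.
Proof.
rewrite /norm1 (bigD1 i)//= lerDl; apply: sumr_ge0 => j _; exact: normr_ge0.
Qed.

(** Some 2 x 2 minor of the rows m and w is nonzero. The part A k w of m does not
    contribute to it, so it is a multiple of A q; and it is at most 2 |w| |m|. On
    the other hand A q n = m - A k w with k < q, which bounds A q |n| in terms of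
    |m| and A q |w|. *)
Lemma off_line_size m k n : in_dual m k n -> ~ parallel m -> (0 <= k < q%:Z) ->
  A%:R * q%:R * (1 + norm1 R n) <= transverse_const * norm2 (ivec R m).
Proof.
move=> mE npar /andP[k0 kq].
have [i [l il]] : exists i l, tnth m i * tnth w l != tnth m l * tnth w i.
  apply: contrapT => h; apply: npar => i l; apply/eqP; apply: contrapT => /negP h'.
  by apply: h; exists i, l.
set M := norm2 (ivec R m); set W := norm1 R w.
have M0 : 0 <= M by exact: norm2_ge0.
have W0 : 0 <= W by exact: norm1_ge0.
have AR : 0 < A%:R :> R by rewrite ltr0n.
have qR : 0 < q%:R :> R by rewrite ltr0n.
have mM j : `|(tnth m j)%:~R| <= M.
  by have := coord_le_norm2 (ivec R m) j; rewrite tnth_mktuple.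
have wW j : `|(tnth w j)%:~R| <= W by exact: coord_le_norm1.
have h1 : A%:R * q%:R <= 2 * W * M.
  have E : tnth m i * tnth w l - tnth m l * tnth w i =
      A%:Z * q%:Z * (tnth n i * tnth w l - tnth n l * tnth w i).
    by rewrite !mE; ring.
  have nz : tnth n i * tnth w l - tnth n l * tnth w i != 0.
    by move: il; rewrite -subr_eq0 E mulf_eq0 negb_or => /andP[].
  have : A%:R * q%:R <= `|(tnth m i * tnth w l - tnth m l * tnth w i)%:~R : R|.
    rewrite E !intrM !normrM -!pmulrn !normr_nat -[leLHS]mulr1 ler_pM2l ?mulr_gt0//.
    by rewrite -intr_norm -[1]/(1%:~R) ler_int -gtz0_ge1 normr_gt0.
  move=> /le_trans; apply; rewrite intrB !intrM.
  apply: le_trans (ler_normB _ _) _; rewrite !normrM.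
  rewrite (_ : 2 * W * M = M * W + M * W); last by ring.
  by apply: lerD; apply: ler_pM.
have h2 : A%:R * q%:R * norm1 R n <= d%:R * M + A%:R * q%:R * W.
  have -> : d%:R * M = \sum_(j < d) M by rewrite sumr_const card_ord mulr_natl.
  rewrite /W /norm1 !big_distrr/= -big_split/=; apply: ler_sum => j _.
  have -> : A%:R * q%:R * `|(tnth n j)%:~R| = `|(A%:Z * q%:Z * tnth n j)%:~R| :> R.
    by rewrite !intrM !normrM -!pmulrn !normr_nat.
  have -> : A%:Z * q%:Z * tnth n j = tnth m j - A%:Z * k * tnth w j by rewrite mE; ring.
  rewrite intrB; apply: le_trans (ler_normB _ _) _; apply: lerD => //.
  rewrite !intrM !normrM -!pmulrn normr_nat -!mulrA ler_pM2l//.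
  apply: ler_wpM2r => //; rewrite -intr_norm (_ : q%:R = q%:Z%:~R)// ler_int.
  by rewrite ger0_norm// ltW.
rewrite /transverse_const -/W.
have h3 : A%:R * q%:R * (1 + W) <= 2 * W * M * (1 + W) by rewrite ler_wpM2r// addr_ge0.
by move: h2 h3; move: (A%:R * q%:R) => Q; nra.
Qed.

Lemma on_line_coord m m' : parallel m -> m != izero d ->
  (forall i, tnth m i = A%:Z * tnth m' i) -> tnth m' i0 != 0.
Proof.
move=> par m0 mE; apply: contraNN m0 => /eqP h; apply/eqP/eq_from_tnth => i.
rewrite tnth_mktuple; have := par i i0; rewrite [tnth m i0]mE h mulr0 mul0r.
by move/eqP; rewrite mulf_eq0 (negbTE wi0) orbF => /eqP.
Qed.

(** The two sides are homogeneous of degree one in absolute value, and m is a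
    nonzero real multiple of w. *)
Lemma on_line_cone m (v : d.-tuple R) (beta : R) : parallel m -> m != izero d ->
  beta * norm2 (ivec R w) < `|dotp (ivec R w) v| ->
  beta * norm2 (ivec R m) < `|dotp (ivec R m) v|.
Proof.
move=> par m0 hw; pose tau : R := (tnth m i0)%:~R / (tnth w i0)%:~R.
have wR : (tnth w i0)%:~R != 0 :> R by rewrite intr_eq0.
have mw i : tnth (ivec R m) i = tau * tnth (ivec R w) i.
  rewrite !tnth_mktuple /tau mulrAC; apply: (canRL (mulfK wR)).
  by rewrite -!intrM par.
have tau0 : tau != 0.
  apply: contraNN m0 => /eqP t0; apply/eqP/eq_from_tnth => i.
  rewrite tnth_mktuple; have := mw i; rewrite t0 mul0r tnth_mktuple => /eqP.
  by rewrite intr_eq0 => /eqP.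
have -> : dotp (ivec R m) v = tau * dotp (ivec R w) v.
  by rewrite /dotp big_distrr/=; apply: eq_bigr => i _; rewrite mw mulrA.
rewrite (norm2_scale mw) (normrM tau) mulrCA ltr_pM2l//.
by rewrite normr_gt0.
Qed.

End dual_lattice.

Lemma inv_pow_le (R : realType) (x y c : R) n : 0 < x -> 0 < y -> y <= c * x ->
  x ^- n <= c ^+ n * y ^- n.
Proof.
move=> x0 y0 yx; rewrite ler_pdivlMr ?exprn_gt0// mulrC ler_pdivrMr ?exprn_gt0//.
rewrite -exprMn; apply: lerXn2r => //; rewrite nnegrE ltW//.
exact: lt_le_trans yx.
Qed.

Section dual_lattice_sum.
Context (R : realType) (d : nat).
Variables (w : d.-tuple int) (i0 : 'I_d) (wi0 : tnth w i0 != 0).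
Variables (v : d.-tuple R) (beta kappa rho0 : R).
Hypotheses (kappa_gt0 : 0 < kappa).
Hypothesis w_cone : beta * norm2 (ivec R w) < `|dotp (ivec R w) v|.
Variables (G S : d.-tuple int -> R).
Hypotheses (G_ge0 : forall m, 0 <= G m) (S_ge0 : forall m, 0 <= S m).
Hypothesis decay : forall m, rho0 <= norm2 (ivec R m) ->
  G m <= kappa / norm2 (ivec R m) ^+ (d + 1) /\
  (beta * norm2 (ivec R m) < `|dotp (ivec R m) v| ->
   G m <= kappa / norm2 (ivec R m) ^+ (d + 2)).
Variables (A q : nat) (B : R).
Hypotheses (A_gt0 : (0 < A)%N) (q_gt0 : (0 < q)%N) (A_large : rho0 <= A%:R).
Hypotheses (B_ge0 : 0 <= B) (S_le : forall m, S m <= B).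
Hypothesis S_dual : forall m, S m != 0 -> exists k n, in_dual w A q m k n.

Let C := transverse_const R w.

(** Subtracting from k a multiple of q only changes n. *)
Lemma S_dual_mod m : S m != 0 ->
  exists (k : 'I_q) (n : d.-tuple int), in_dual w A q m (k : nat)%:Z n.
Proof.
move=> /S_dual[k [n mE]].
have q0 : q%:Z != 0 by rewrite eqz_nat -lt0n.
have k0 : 0 <= (k %% q%:Z)%Z by exact: modz_ge0.
have kq : (k %% q%:Z)%Z < q%:Z by rewrite ltz_pmod// ltz_nat.
have kqn : (`|(k %% q%:Z)%Z| < q)%N by rewrite -ltz_nat gez0_abs.
exists (Ordinal kqn), [tuple tnth n i + (k %/ q%:Z)%Z * tnth w i | i < d] => i /=.
rewrite mE tnth_mktuple gez0_abs// {1}(divz_eq k q%:Z); congr (_ * _); ring.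
Qed.

Lemma dual_size m : m != izero d -> S m != 0 -> A%:R <= norm2 (ivec R m).
Proof.
move=> m0 /S_dual[k [n mE]].
have [i mi] : exists i, tnth m i != 0.
  apply/existsP; apply: contraNT m0 => /existsPn h.
  by apply/eqP/eq_from_tnth => i; rewrite tnth_mktuple; have := h i; rewrite negbK => /eqP.
apply: le_trans (coord_le_norm2 _ i); rewrite tnth_mktuple.
move: mi; rewrite mE mulf_eq0 negb_or => /andP[_ h].
rewrite intrM normrM -pmulrn normr_nat ler_peMr//.
by rewrite -intr_norm -[1]/(1%:~R) ler_int -gtz0_ge1 normr_gt0.
Qed.

(** On the line a point is determined by its i0-th coordinate, an integer multiple
    of A, so the sum is compared with one over the integers. *)
Lemma on_line_sum :
  (\esum_(m in [set m | m != izero d] `&` parallel w) (G m * S m)%:E <=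
   (B * kappa * 2 ^+ (d + 2) / A%:R ^+ (d + 2) * 3)%:E)%E.
Proof.
have AR : 0 < A%:R :> R by rewrite ltr0n.
pose c := B * kappa * 2 ^+ (d + 2) / A%:R ^+ (d + 2).
have c0 : 0 <= c.
  by rewrite /c divr_ge0// ?exprn_ge0// !mulr_ge0// ?exprn_ge0// ltW.
pose h (k : int) : \bar R := (c%:E * ((1 + `|k%:~R|) ^- (d + 2))%:E)%E.
have h0 k : (0 <= h k)%E.
  by apply: mule_ge0; rewrite lee_fin// invr_ge0 exprn_ge0// addr_ge0.
have dualA m : S m != 0 -> exists m', forall i, tnth m i = A%:Z * tnth m' i.
  move=> /S_dual[k [n mE]].
  by exists [tuple k * tnth w i + q%:Z * tnth n i | i < d] => i; rewrite tnth_mktuple.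
have SNz m : (G m * S m)%:E != 0%E -> S m != 0.
  by apply: contraNN => /eqP ->; rewrite mulr0.
have AZ : A%:Z != 0 by rewrite eqz_nat -lt0n.
apply: (@le_trans _ _ (\esum_(k in [set: int]) h k)%E).
  apply: (@esum_le_via _ _ _ _ _ (fun m => (tnth m i0 %/ A%:Z)%Z)) => //.
  - by move=> m; rewrite lee_fin mulr_ge0.
  - move=> m [m0 par] /SNz Sm.
    have [m' mE] := dualA _ Sm.
    have m'0 := on_line_coord wi0 par m0 mE.
    have big := dual_size m0 Sm.
    have [_ dec] := decay (le_trans A_large big).
    have {}dec := dec (on_line_cone wi0 par m0 w_cone).
    rewrite mE [A%:Z * _]mulrC mulzK// /h -EFinM lee_fin.
    set K : R := `|(tnth m' i0)%:~R|.
    have K1 : 1 <= K.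
      by rewrite /K -intr_norm -[1]/(1%:~R) ler_int -gtz0_ge1 normr_gt0.
    have hM : A%:R * (1 + K) <= 2 * norm2 (ivec R m).
      have : A%:R * K <= norm2 (ivec R m).
        apply: le_trans (coord_le_norm2 _ i0); rewrite tnth_mktuple mE intrM normrM.
        by rewrite -pmulrn normr_nat.
      nra.
    have M0 : 0 < norm2 (ivec R m) by exact: lt_le_trans big.
    apply: (@le_trans _ _ (B * (kappa / norm2 (ivec R m) ^+ (d + 2)))).
      by rewrite mulrC; apply: ler_pM.
    have K0 : 0 < 1 + K by lra.
    have := inv_pow_le (d + 2) M0 (mulr_gt0 AR K0) hM.
    rewrite exprMn invfM => h'.
    by rewrite /c -!mulrA ler_wpM2l// ler_pM2l// mulrA.
  - move=> m n [m0 parm] [n0 parn] /SNz/dualA[m' mE] /SNz/dualA[n' nE].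
    rewrite mE nE ![A%:Z * _]mulrC !mulzK// => mn.
    apply: eq_from_tnth => i; apply: (mulIf wi0).
    by rewrite parm parn mE nE mn.
have inv0 (k : int) : (0 <= ((1 + `|k%:~R|) ^- (d + 2))%:E :> \bar R)%E.
  by rewrite lee_fin invr_ge0 exprn_ge0// addr_ge0.
apply: le_trans (esumZ_le [set: int] c0 inv0) _.
rewrite -/c (EFinM c 3); apply: lee_wpmul2l; first by rewrite lee_fin.
have := @esum_int_inv_pow R 1 (d + 1) (lexx _).
by rewrite addn1 expr1n invr1 mulr1 addn2; apply.
Qed.

(** The sum is compared with one over the pairs (k, n) with 0 <= k < q. *)
Lemma off_line_sum :
  (\esum_(m in [set m | m != izero d] `&` ~` parallel w) (G m * S m)%:E <=
   (q%:R * (B * kappa * C ^+ (d + 1) / (A%:R * q%:R) ^+ (d + 1) * 3 ^+ d))%:E)%E.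
Proof.
have AR : 0 < A%:R :> R by rewrite ltr0n.
have qR : 0 < q%:R :> R by rewrite ltr0n.
have C0 : 0 <= C.
  by rewrite /C /transverse_const !(addr_ge0, mulr_ge0)// norm1_ge0.
pose c := B * kappa * C ^+ (d + 1) / (A%:R * q%:R) ^+ (d + 1).
have c0 : 0 <= c.
  by rewrite /c divr_ge0// ?exprn_ge0// !mulr_ge0// ?exprn_ge0// ltW.
pose h (p : 'I_q * d.-tuple int) : \bar R := (c%:E * ((1 + norm1 R p.2) ^- (d + 1))%:E)%E.
have inv0 (n : d.-tuple int) : (0 <= ((1 + norm1 R n) ^- (d + 1))%:E)%E.
  by rewrite lee_fin invr_ge0 exprn_ge0// addr_ge0// norm1_ge0.
have h0 p : (0 <= h p)%E by apply: mule_ge0; rewrite // lee_fin.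
have SNz m : (G m * S m)%:E != 0%E -> S m != 0.
  by apply: contraNN => /eqP ->; rewrite mulr0.
have /choice[phi phiP] : forall m, exists p : 'I_q * d.-tuple int,
    S m != 0 -> in_dual w A q m (p.1 : nat)%:Z p.2.
  move=> m; have [Sm|Sm] := eqVneq (S m) 0.
    by exists (Ordinal q_gt0, izero d).
  by have [k [n mE]] := S_dual_mod Sm; exists (k, n).
apply: (@le_trans _ _ (\esum_(p in [set: 'I_q * d.-tuple int]) h p)%E).
  apply: (@esum_le_via _ _ _ _ _ phi) => //.
  - by move=> m; rewrite lee_fin mulr_ge0.
  - move=> m [m0 npar] /SNz Sm.
    have big := dual_size m0 Sm.
    have [dec _] := decay (le_trans A_large big).
    have kq : (0 <= ((phi m).1 : nat)%:Z < q%:Z) by rewrite le0z_nat ltz_nat ltn_ord.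
    have hM := @off_line_size R _ _ _ _ A_gt0 q_gt0 _ _ _ (phiP m Sm) npar kq.
    have M0 : 0 < norm2 (ivec R m) by exact: lt_le_trans big.
    rewrite /h -EFinM lee_fin.
    apply: (@le_trans _ _ (B * (kappa / norm2 (ivec R m) ^+ (d + 1)))).
      by rewrite mulrC; apply: ler_pM.
    have K0 : 0 < 1 + norm1 R (phi m).2 by have := norm1_ge0 R (phi m).2; lra.
    have := inv_pow_le (d + 1) M0 (mulr_gt0 (mulr_gt0 AR qR) K0) hM.
    rewrite exprMn invfM => h'.
    by rewrite /c -!mulrA ler_wpM2l// ler_pM2l// mulrA.
  - move=> m n _ _ /SNz Sm /SNz Sn mn.
    apply: eq_from_tnth => i.
    by rewrite (phiP m Sm) (phiP n Sn) mn.
apply: (@le_trans _ _ (\esum_(k in [set: 'I_q])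
    \esum_(n in [set: d.-tuple int]) h (k, n))%E).
  rewrite esum_esum; last by move=> i j _ _; exact: h0.
  rewrite (_ : _ `*`` _ = setT); last by apply/seteqP; split.
  by apply: le_esum => -[].
have inner (k : 'I_q) : (\esum_(n in [set: d.-tuple int]) h (k, n) <= (c * 3 ^+ d)%:E)%E.
  apply: le_trans (esumZ_le [set: d.-tuple int] c0 inv0) _.
  rewrite (EFinM c); apply: lee_wpmul2l; first by rewrite lee_fin.
  have := @esum_tuple_inv_pow R d 1 1 (lexx _) isT.
  by rewrite expr1n invr1 mulr1.
apply: (@le_trans _ _ (\esum_(k in [set: 'I_q]) (c * 3 ^+ d)%:E)%E).
  by apply: le_esum => k _; exact: inner.
rewrite esum_finType; last by move=> k; rewrite lee_fin mulr_ge0// exprn_ge0.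
by rewrite sumEFin lee_fin sumr_const card_ord -[leLHS]mulr_natl.
Qed.

Lemma dual_lattice_sum :
  (\esum_(m in [set m | m != izero d]) (G m * S m)%:E <=
   (B * kappa * 2 ^+ (d + 2) / A%:R ^+ (d + 2) * 3 +
    q%:R * (B * kappa * C ^+ (d + 1) / (A%:R * q%:R) ^+ (d + 1) * 3 ^+ d))%:E)%E.
Proof.
rewrite (esumID (parallel w)); last by move=> m _; rewrite lee_fin mulr_ge0.
by rewrite EFinD; apply: leeD; [exact: on_line_sum|exact: off_line_sum].
Qed.

End dual_lattice_sum.

(** * Point sets of small discrepancy *)

(** The hypothesis in polar coordinates, read at integer points. For large rho the
    second rate is stronger than the first, so the first bound holds in every
    direction. *)
Lemma fourier_decay_ivec (R : realType) (d : nat) (Omega : set (d.-tuple R))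
  (kappa beta : R) (v : d.-tuple R) : 0 < kappa ->
  (\forall rho \near +oo,
     forall Theta : d.-tuple R, unit_sphere Theta ->
       ComplexField.Normc.normc (fourier_indic Omega (scalev rho Theta)) ^+ 2
       <= (if `|dotp Theta v| <= beta
           then kappa / rho ^+ (d + 1) else kappa / rho ^+ (d + 2))) ->
  exists rho0 : R, forall m : d.-tuple int, rho0 <= norm2 (ivec R m) ->
    let g := ComplexField.Normc.normc (fourier_indic Omega (ivec R m)) ^+ 2 in
    g <= kappa / norm2 (ivec R m) ^+ (d + 1) /\
    (beta * norm2 (ivec R m) < `|dotp (ivec R m) v| ->
     g <= kappa / norm2 (ivec R m) ^+ (d + 2)).
Proof.
move=> kappa0 [M [_ hM]]; exists (Num.max (M + 1) 1) => m.
set x := ivec R m; set rho := norm2 x.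
rewrite ge_max => /andP[h1 h2].
have rho0 : 0 < rho by lra.
have rhoM : M < rho by lra.
pose Theta := scalev rho^-1 x.
have ThetaE i : tnth Theta i = rho^-1 * tnth x i by rewrite tnth_mktuple.
have uT : unit_sphere Theta.
  rewrite /unit_sphere /= -/(norm2 Theta) (norm2_scale ThetaE) ger0_norm ?invr_ge0 ?ltW//.
  by rewrite mulVf// gt_eqF.
have xE : scalev rho Theta = x.
  apply: eq_from_tnth => i; rewrite tnth_mktuple ThetaE mulrA mulfV ?mul1r//.
  by rewrite gt_eqF.
have := hM _ rhoM _ uT; rewrite xE => h g.
have hv : dotp Theta v = rho^-1 * dotp x v.
  by rewrite /dotp big_distrr/=; apply: eq_bigr => i _; rewrite ThetaE mulrA.
split.
  apply: le_trans h _; case: ifP => // _.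
  rewrite ler_pM2l// lef_pV2 ?posrE ?exprn_gt0//.
  by apply: ler_weXn2l => //; rewrite leq_add2l.
move=> cone; move: h; rewrite ifF//.
apply/negbTE; rewrite -ltNge hv normrM gtr0_norm ?invr_gt0//.
by rewrite ltr_pdivlMl// mulrC.
Qed.

(** With M = d^2 + d - 1, the exponent M (1 - (d + 1) / M) is d^2 - 2. *)
Lemma powR_exponent (R : realType) (d' q : nat) (d := d'.+1) :
  (0 < d')%N -> (0 < q)%N ->
  (q ^ (d * d + d'))%:R `^ (1 - (d%:R + 1) / (d%:R ^+ 2 + d%:R - 1)) =
  q%:R ^+ (d * d - 2) :> R.
Proof.
move=> d'_gt0 q_gt0; have qR : 0 < q%:R :> R by rewrite ltr0n.
have ME : (d * d + d')%:R = d%:R ^+ 2 + d%:R - 1 :> R.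
  by rewrite natrD natrM expr2 /d -natr1; ring.
have M0 : d%:R ^+ 2 + d%:R - 1 != 0 :> R by rewrite -ME pnatr_eq0 addn_eq0.
rewrite natrX -powR_mulrn ?ltW// -powRrM -powR_mulrn ?ltW//; congr (_ `^ _).
rewrite natrB; last by rewrite /d; nia.
by rewrite ME natrM; field.
Qed.

Theorem theorem1p4 (R : realType) (d : nat) (d_ge2 : (2 <= d)%N)
  (Omega : set (d.-tuple R))
  (Omega_cube : Omega `<=` unit_cube R d)
  (Omega_measurable : lebesgue_measurable Omega)
  (kappa2 beta2 : R) (v : d.-tuple R)
  (kappa2_gt0 : 0 < kappa2)
  (beta2_gt0 : 0 < beta2) (beta2_lt1 : beta2 < 1)
  (v_sphere : unit_sphere v)
  (fourier_decay : \forall rho \near +oo,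
     forall Theta : d.-tuple R, unit_sphere Theta ->
       ComplexField.Normc.normc (fourier_indic Omega (scalev rho Theta)) ^+ 2
       <= (if `|dotp Theta v| <= beta2
           then kappa2 / rho ^+ (d + 1) else kappa2 / rho ^+ (d + 2))) :
  exists2 c : R, 0 < c &
  exists2 N : nat -> nat, N @ \oo --> \oo &
  forall j : nat,
  exists2 z : 'I_(N j) -> d.-tuple R, (forall k, unit_cube R d (z k)) &
    (\int[lebesgue R d]_(x in unit_cube R d)
       (`|discrepancy Omega z x| ^+ 2)%:E
     <= (c * (N j)%:R `^ (1 - (d%:R + 1) / (d%:R ^+ 2 + d%:R - 1)))%:E)%E.
Proof.
case: d d_ge2 => // d' d'_gt0 in Omega v Omega_cube Omega_measurable v_sphere
  fourier_decay *.
set d := d'.+1 in Omega v Omega_cube Omega_measurable v_sphere fourier_decay *.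
have [E [Z EZ]] := ex_borel_model Omega_cube Omega_measurable.
have [[mE _ _ _] _] := EZ.
have [rho0 decay] := fourier_decay_ivec kappa2_gt0 fourier_decay.
have [w wcone] : exists w, beta2 * norm2 (ivec R w) < `|dotp (ivec R w) v|.
  by apply: integer_direction; rewrite ?beta2_gt0.
have [i0 wi0] : exists i, tnth w i != 0.
  apply: contrapT => h.
  have w0 i : tnth (ivec R w) i = 0.
    rewrite tnth_mktuple; apply/eqP; rewrite intr_eq0; apply/negP => /negP hi.
    by apply: h; exists i.
  move: wcone; rewrite (_ : dotp _ _ = 0) ?normr0; last first.
    by rewrite /dotp big1// => i _; rewrite w0 mul0r.
  by apply/negP; rewrite -leNgt mulr_ge0 ?norm2_ge0// ltW.
pose a : nat := `|tnth w i0|%N.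
have a_gt0 : (0 < a)%N by rewrite absz_gt0.
pose j0 : nat := (Num.truncn rho0).+1.
(* Congruent to 1 modulo a, so that w_i0 is invertible modulo T. *)
pose T (j : nat) : nat := (a * (j + j0)).+1.
pose N (j : nat) : nat := #|{: point_index d' (T j ^ d) (T j)}|.
have NE j : N j = (T j ^ (d * d + d'))%N.
  by rewrite /N card_point_index -expnM -expnD.
pose C : R := transverse_const R w.
have C_ge0 : 0 <= C.
  by rewrite /C /transverse_const !(addr_ge0, mulr_ge0)// norm1_ge0.
pose c : R := kappa2 * 2 ^+ (d + 2) * 3 + kappa2 * C ^+ (d + 1) * 3 ^+ d.
have c_gt0 : 0 < c.
  rewrite /c ltr_pwDl//; first by rewrite !mulr_gt0// exprn_gt0.
  by rewrite !mulr_ge0 ?exprn_ge0// ltW.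
exists c => //; exists N.
  apply/cvgnyPge => k; near=> j; rewrite NE.
  apply: (@leq_trans (T j)).
    apply: (@leq_trans j); first by near: j; exact: nbhs_infty_ge.
    rewrite /T; nia.
  by rewrite -[X in (X <= _)%N]expn1 leq_pexp2l//; lia.
move=> j.
pose A : nat := (T j ^ d)%N.
pose q : nat := T j.
have q_gt0 : (0 < q)%N by [].
have A_gt0 : (0 < A)%N by rewrite expn_gt0 q_gt0.
have rho0A : rho0 <= A%:R.
  apply: (@le_trans _ _ (j0%:R)); first by rewrite ltW// Num.Theory.truncnS_gt.
  rewrite ler_nat /A; apply: (@leq_trans (T j)); first by rewrite /T; nia.
  by rewrite -[X in (X <= _)%N]expn1 leq_pexp2l.
(* Since T = a (j + j0) + 1 with a = |w_i0|, this b inverts w_i0 modulo T. *)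
pose b : int := - Num.sg (tnth w i0) * (j + j0)%:Z.
have wb : (q%:Z %| tnth w i0 * b - 1)%Z.
  have aE : tnth w i0 * Num.sg (tnth w i0) = a%:Z by rewrite /a abszE normrEsg mulrC.
  have qE : q%:Z = a%:Z * (j + j0)%:Z + 1 by rewrite -PoszM -[1]/(Posz 1) -PoszD addn1.
  by apply/dvdzP; exists (-1); rewrite qE -aE /b; ring.
pose y : 'I_(N j) -> d.-tuple R := fun k => raw_point R (tnth w) i0 b (enum_val k).
pose o : d.-tuple R := [tuple 0 | i < d].
have mo m : idot m o = 0 by rewrite /idot big1// => i _; rewrite tnth_mktuple mulr0.
pose z : 'I_(N j) -> d.-tuple R := fun k => fold_shift o (y k).
exists z; first by move=> k; exact: unit_cube_fold_shift.
apply: le_trans (integral_discrepancy_le Omega_cube Omega_measurable EZ z) _.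
apply: le_trans (discrepancy_spectral_bound mE z) _.
have Sy m : expsum_sqr z m = expsum_sqr (@raw_point R d' (tnth w) i0 A q b) m.
  rewrite (expsum_sqr_fold y (mo m)) /expsum_sqr /y.
  by congr (_ ^+ 2 + _ ^+ 2);
    rewrite [RHS](reindex (@enum_val (point_index d' A q) predT))//;
    exact/onW_bij/enum_val_bij.
have S_ge0 m : 0 <= expsum_sqr z m by rewrite addr_ge0 ?sqr_ge0.
have S_le m : expsum_sqr z m <= (N j)%:R ^+ 2.
  by have := expsum_sqr_le z m; rewrite card_ord.
have S_dual m : expsum_sqr z m != 0 -> exists k n, in_dual w A q m k n.
  rewrite Sy => /(raw_point_dual A_gt0 q_gt0 wb)[k [n mE']].
  by exists k, [tuple n i | i < d] => i; rewrite mE' tnth_mktuple.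
pose G m : R := tcos (\1_E : _ -> R) m ^+ 2 + tsin (\1_E : _ -> R) m ^+ 2.
have G_ge0 m : 0 <= G m by rewrite addr_ge0 ?sqr_ge0.
have decayG m : rho0 <= norm2 (ivec R m) ->
    G m <= kappa2 / norm2 (ivec R m) ^+ (d + 1) /\
    (beta2 * norm2 (ivec R m) < `|dotp (ivec R m) v| ->
     G m <= kappa2 / norm2 (ivec R m) ^+ (d + 2)).
  move=> /decay.
  by rewrite /= (normc_fourier_indic Omega_cube Omega_measurable EZ).
apply: le_trans (dual_lattice_sum wi0 kappa2_gt0 wcone G_ge0 S_ge0 decayG
  A_gt0 q_gt0 rho0A (exprn_ge0 2 (ler0n _ _)) S_le S_dual) _.
rewrite lee_fin -/C.
(* With A = T^d and q = T, every term below is a power of T, and both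
   contributions equal T^(d^2-2) up to a constant. *)
have qR : 0 < q%:R :> R by rewrite ltr0n.
have AE : A%:R = q%:R ^+ d :> R by rewrite natrX.
have NR : (N j)%:R = q%:R ^+ (d * d + d') :> R by rewrite NE natrX.
have := @powR_exponent R d' q d'_gt0 q_gt0; rewrite -NE => ->.
have key : (N j)%:R ^+ 2 = q%:R ^+ (d * d - 2) * A%:R ^+ (d + 2) :> R.
  rewrite NR AE -!exprM -exprD; congr (_ ^+ _).
  by rewrite /d; nia.
have A0 : A%:R ^+ (d + 2) != 0 :> R by rewrite expf_neq0// AE expf_neq0// gt_eqF.
have q0 : q%:R != 0 :> R by rewrite gt_eqF.
have Aq : (A%:R * q%:R) ^+ (d + 1) = A%:R ^+ (d + 2) * q%:R :> R.
  by rewrite exprMn AE -!exprM -!exprD -exprSr; congr (_ ^+ _); rewrite /d; nia.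
rewrite Aq key /c le_eqVlt; apply/orP; left; apply/eqP.
by field; rewrite A0 q0.
Unshelve. all: by end_near.
Qed.
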